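(* Let $G$ be a Frölicher group with identity $e$, let $\mathfrak g = T_eG$, and let $\Xi:\mathfrak g \to T_0\mathfrak g$ be the map sending $v$ to $[s \mapsto sv]$. If $\Xi$ is bijective, then the operation $[\cdot,\cdot]$ on $\mathfrak g$ defined by $[v,w] = \Xi^{-1}(\xi)$, where for $v=[c]$, $w=[d]$ the element $\xi \in T_0\mathfrak g$ is represented by $\gamma(s,t) = c(s)d(t)c(s)^{-1}d(t)^{-1}$ (that is, $\xi = [s \mapsto [t \mapsto \gamma(s,t)]]$), is a Lie bracket. Moreover, let $H$ be another Frölicher group for which $\mathfrak h = T_eH$ has the property that $\Xi:\mathfrak h \to T_0\mathfrak h$ is bijective. If $\alpha:G\to H$ is a smooth group homomorphism, then $T\alpha:\mathfrak g\to\mathfrak h$ is a morphism of Lie algebras (for the brackets on $\mathfrak g$ and $\mathfrak h$ so defined).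
   Context: A Frölicher structure on a set $X$ is a pair $(C,F)$ with $C \subset \mathrm{Map}(\mathbb R,X)$ and $F\subset \mathrm{Map}(X,\mathbb R)$ such that $C=\{c:\mathbb R\to X \mid f\circ c\in C^\infty(\mathbb R,\mathbb R)\ \forall f\in F\}$ and $F=\{f:X\to\mathbb R\mid f\circ c\in C^\infty(\mathbb R,\mathbb R)\ \forall c\in C\}$. Elements of $C$ and $F$ are called (smooth) curves and (smooth) functions; $(X,C,F)$ is a Frölicher space. A map $\phi:X\to Y$ of Frölicher spaces is smooth if $\phi\circ c$ is a curve of $Y$ for every curve $c$ of $X$. Given a set $X$ and maps $f_i:X\to X_i$ into Frölicher spaces, the initial structure on $X$ is the Frölicher structure whose curves are those $c:\mathbb R\to X$ with every $f_i\circ c$ a curve of $X_i$. Subsets carry the initial structure with respect to the inclusion, products the initial structure with respect to the projections. Tangent spaces: for $x\in X$ let $C_x=\{c\in C: c(0)=x\}$; $c\sim d$ in $C_x$ iff $(f\circ c)'(0)=(f\circ d)'(0)$ for all $f\in F$; $T_xX=C_x/\!\sim$, with classes $[c]=[s\mapsto c(s)]$. One says $u=v+rw$ for $u=[a],v=[c],w=[d]\in T_xX$, $r\in\mathbb R$, if $(f\circ a)'(0)=(f\circ c)'(0)+r(f\circ d)'(0)$ for all $f\in F$. $TX$ is the disjoint union of the $T_xX$. For smooth $\phi:X\to Y$, $T\phi([c])=[\phi\circ c]$. $T\mathbb R$ is identified with $\mathbb R^2$ via $[c]\mapsto(c(0),c'(0))$, and $TX$ carries the initial Frölicher structure with respect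 to all $Tf:TX\to T\mathbb R=\mathbb R^2$, $f\in F$. Each $T_xX\subset TX$ carries the subset structure. A Frölicher group is a group with a Frölicher structure such that multiplication $G\times G\to G$ and inversion are smooth. For a Frölicher group $G$, $T_eG$ is a vector space with the addition and scalar multiplication just described; explicitly $[c]+[d]=[s\mapsto c(s)d(s)]$ and $r[c]=[s\mapsto c(rs)]$. $T_0\mathfrak g$ is the tangent space at $0$ of the Frölicher space $\mathfrak g=T_eG$. *)

(* Defs.v *)
(* Real analysis is that of the Stdlib reals, through Coquelicot; groups are
   the (possibly infinite) [groupType]s of MathComp. *)
From Stdlib Require Import Reals Lra Lia.
From Stdlib Require Import FunctionalExtensionality PropExtensionality.
From Stdlib Require Import ProofIrrelevance ClassicalEpsilon.
From Coquelicot Require Import Coquelicot.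
From mathcomp Require Import ssreflect ssrfun ssrbool eqtype choice monoid.

Set Implicit Arguments.
Unset Strict Implicit.
Unset Printing Implicit Defensive.

Local Open Scope R_scope.

Definition smooth (f : R -> R) : Prop := forall (n : nat) (x : R), ex_derive_n f n x.

Lemma smooth_ext (f g : R -> R) : (forall x, f x = g x) -> smooth f -> smooth g.
Proof. by move=> e sf n x; apply: (ex_derive_n_ext f) => //; apply: sf. Qed.

Lemma smooth_const (a : R) : smooth (fun _ => a).
Proof. by move=> n x; apply: ex_derive_n_const. Qed.

Lemma smooth_scal_r (a : R) : smooth (fun s => s * a).
Proof.
move=> n x; apply: (ex_derive_n_scal_r (fun s => s)).
by apply: (ex_derive_n_ext (fun s => s ^ 1)) => [t|]; [ring | apply: ex_derive_n_pow].
Qed.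

Lemma smooth_id : smooth (fun s => s).
Proof. by apply: (smooth_ext _ (smooth_scal_r 1)) => x; ring. Qed.

Fixpoint diff_upto (n : nat) (f : R -> R) : Prop :=
  if n is S m then (forall x, ex_derive f x) /\ diff_upto m (Derive f) else True.

Lemma diff_upto_ext n (f g : R -> R) :
  (forall x, f x = g x) -> diff_upto n f -> diff_upto n g.
Proof. by move=> /functional_extensionality ->. Qed.

Lemma diff_upto_pred n f : diff_upto (S n) f -> diff_upto n f.
Proof.
elim: n f => [|n IHn] f //= [df [ddf dndf]].
by split=> //; apply: IHn.
Qed.

Lemma diff_upto_plus n (f g : R -> R) :
  diff_upto n f -> diff_upto n g -> diff_upto n (fun x => f x + g x).
Proof.
elim: n f g => [|n IHn] f g //= [df dnf] [dg dng]; split=> [x|].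
  exact: (@ex_derive_plus R_AbsRing R_NormedModule f g).
apply: (@diff_upto_ext _ (fun x => Derive f x + Derive g x)).
  by move=> x; rewrite Derive_plus.
exact: IHn.
Qed.

Lemma diff_upto_mult n (f g : R -> R) :
  diff_upto n f -> diff_upto n g -> diff_upto n (fun x => f x * g x).
Proof.
elim: n f g => [|n IHn] f g // dfS dgS.
have dnf := diff_upto_pred dfS; have dng := diff_upto_pred dgS.
case: dfS dgS => /= df df' [dg dg']; split=> [x|].
  by apply: ex_derive_mult.
apply: (@diff_upto_ext _ (fun x => Derive f x * g x + f x * Derive g x)).
  by move=> x; rewrite Derive_mult.
by apply: diff_upto_plus; apply: IHn.
Qed.

Lemma diff_upto_comp n (f g : R -> R) :
  diff_upto n f -> diff_upto n g -> diff_upto n (fun x => f (g x)).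
Proof.
elim: n f g => [|n IHn] f g // dfS dgS.
have dng := diff_upto_pred dgS.
case: dfS dgS => /= df df' [dg dg']; split=> [x|].
  by apply: ex_derive_comp.
apply: (@diff_upto_ext _ (fun x => Derive g x * Derive f (g x))).
  by move=> x; rewrite (Derive_comp f g).
by apply: diff_upto_mult => //; apply: IHn.
Qed.

Lemma smoothP (f : R -> R) : smooth f <-> forall n, diff_upto n f.
Proof.
have shift (g : R -> R) n x : Derive_n (Derive g) n x = Derive_n g (S n) x.
  by have := Derive_n_comp g n 1 x; rewrite Nat.add_1_r.
split=> [sf n|df].
  elim: n f sf => [|n IHn] f sf //=; split=> [x|]; first exact: (sf 1%nat x).
  apply: IHn => -[|k] x //=.
  apply: (ex_derive_ext (Derive_n f (S k))); last exact: (sf (S (S k)) x).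
  by move=> t; rewrite shift.
move=> n; elim: n f df => [|n IHn] f df x //.
case: n IHn => [|n] IHn; first by have [h _] := df 1%nat; apply: h.
have /IHn/(_ x) /= : forall m, diff_upto m (Derive f).
  by move=> m; have [] := df (S m).
by apply: ex_derive_ext => t; rewrite shift.
Qed.

Lemma smooth_comp (f g : R -> R) :
  smooth f -> smooth g -> smooth (fun x => f (g x)).
Proof.
by move=> /smoothP sf /smoothP sg; apply/smoothP => n; apply: diff_upto_comp.
Qed.

Record FrolicherStructure (X : Type) := MkFrolicherStructure {
  str_curve : (R -> X) -> Prop;
  str_fun : (X -> R) -> Prop;
  str_curveP : forall c : R -> X,
    str_curve c <-> forall f, str_fun f -> smooth (fun s => f (c s));
  str_funP : forall f : X -> R,
    str_fun f <-> forall c, str_curve c -> smooth (fun s => f (c s))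
}.

Record FrolicherSpace := MkFrolicherSpace {
  carrier :> Type;
  structure : FrolicherStructure carrier
}.

Definition curve (X : FrolicherSpace) (c : R -> X) : Prop := str_curve (structure X) c.
Definition smooth_fun (X : FrolicherSpace) (f : X -> R) : Prop := str_fun (structure X) f.

Arguments curve X c : clear implicits.
Arguments smooth_fun X f : clear implicits.

Lemma curveP (X : FrolicherSpace) (c : R -> X) :
  curve X c <-> forall f, smooth_fun X f -> smooth (fun s => f (c s)).
Proof. exact: str_curveP. Qed.

Lemma smooth_funP (X : FrolicherSpace) (f : X -> R) :
  smooth_fun X f <-> forall c, curve X c -> smooth (fun s => f (c s)).
Proof. exact: str_funP. Qed.

Definition smooth_map (X Y : FrolicherSpace) (phi : X -> Y) : Prop :=
  forall c : R -> X, curve X c -> curve Y (fun s => phi (c s)).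

Section Initial.
Variables (A I : Type) (Y : I -> FrolicherSpace) (f : forall i, A -> Y i).

Definition initial_curve (c : R -> A) : Prop :=
  forall i, curve (Y i) (fun s => f i (c s)).
Definition initial_fun (g : A -> R) : Prop :=
  forall c, initial_curve c -> smooth (fun s => g (c s)).

Lemma initial_curveP c :
  initial_curve c <-> forall g, initial_fun g -> smooth (fun s => g (c s)).
Proof.
split=> [cc g|H i]; first exact.
apply/curveP => h hY; apply: (H (fun a => h (f i a))) => d dc.
by have /curveP := dc i; apply.
Qed.

Lemma initial_funP g :
  initial_fun g <-> forall c, initial_curve c -> smooth (fun s => g (c s)).
Proof. by []. Qed.

Definition initial : FrolicherSpace :=
  MkFrolicherSpace (MkFrolicherStructure initial_curveP initial_funP).
End Initial.

Lemma real_lineP (f : R -> R) :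
  smooth f <-> forall g, smooth g -> smooth (fun s => f (g s)).
Proof. by split=> [sf g|/(_ _ smooth_id)//]; apply: smooth_comp. Qed.

Lemma real_lineP' (c : R -> R) :
  smooth c <-> forall f, smooth f -> smooth (fun s => f (c s)).
Proof.
split=> [sc f sf|/(_ _ smooth_id)//]; exact: smooth_comp.
Qed.

Definition real_line : FrolicherSpace :=
  MkFrolicherSpace (MkFrolicherStructure real_lineP' real_lineP).

Definition product (X Y : FrolicherSpace) : FrolicherSpace :=
  @initial (X * Y) bool (fun b => if b then X else Y)
    (fun b => if b return X * Y -> (if b then X else Y) then fst else snd).

Lemma curve_pair (X Y : FrolicherSpace) (c : R -> X) (d : R -> Y) :
  curve X c -> curve Y d -> curve (product X Y) (fun s => (c s, d s)).
Proof. by move=> cc cd [|]. Qed.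

Lemma smooth_fun_map (X : FrolicherSpace) (f : X -> R) :
  smooth_fun X f -> @smooth_map X real_line f.
Proof. by move=> /smooth_funP. Qed.

Lemma curve_const (X : FrolicherSpace) (x : X) : curve X (fun _ => x).
Proof. by apply/curveP => f _; apply: smooth_const. Qed.

Section TangentSpace.
Variables (X : FrolicherSpace) (x : X).

Definition curve_at := {c : R -> X | curve X c /\ c 0 = x}.
Definition curve_at_fun (c : curve_at) : R -> X := proj1_sig c.
Coercion curve_at_fun : curve_at >-> Funclass.

Definition tangent_eq (c d : curve_at) : Prop :=
  forall f, smooth_fun X f ->
    Derive (fun s => f (c s)) 0 = Derive (fun s => f (d s)) 0.

(* Elements of the quotient are equivalence classes, as sets of curves. *)
Definition tangent := {A : curve_at -> Prop | exists c, A = tangent_eq c}.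

Definition cls (c : curve_at) : tangent := exist _ (tangent_eq c) (ex_intro _ c erefl).

Definition repr (v : tangent) : curve_at :=
  proj1_sig (constructive_indefinite_description _ (proj2_sig v)).

Lemma reprK (v : tangent) : cls (repr v) = v.
Proof.
rewrite /repr; case: constructive_indefinite_description => c /= e.
by case: v e => A HA /= e; apply: subset_eq_compat.
Qed.

Lemma clsP (c d : curve_at) : cls c = cls d <-> tangent_eq c d.
Proof.
split=> [[/(f_equal (fun A => A d)) ->] //|ecd].
apply: subset_eq_compat; apply: functional_extensionality => a.
apply: propositional_extensionality; split=> H f Ff.
  by rewrite -ecd // H.
by rewrite ecd // H.
Qed.

Lemma repr_cls (c : curve_at) : tangent_eq (repr (cls c)) c.
Proof. by apply/clsP; rewrite reprK. Qed.

(* The derivative of [f] along [v]: (f o c)'(0) for any c with v = [c]. *)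
Definition dir_deriv (v : tangent) (f : X -> R) : R :=
  Derive (fun s => f (repr v s)) 0.

Lemma dir_deriv_cls (c : curve_at) f :
  smooth_fun X f -> dir_deriv (cls c) f = Derive (fun s => f (c s)) 0.
Proof. exact: repr_cls. Qed.

(* u = v + r w *)
Definition is_lin_comb (u v : tangent) (r : R) (w : tangent) : Prop :=
  forall f, smooth_fun X f -> dir_deriv u f = dir_deriv v f + r * dir_deriv w f.

Definition const_curve : curve_at := exist _ (fun _ => x) (conj (curve_const x) erefl).

Definition tzero : tangent := cls const_curve.

Lemma rescaleP (r : R) (c : curve_at) :
  curve X (fun s => c (r * s)) /\ c (r * 0) = x.
Proof.
case: c => c [cc c0] /=; split; last by rewrite Rmult_0_r.
apply/curveP => f Ff; apply: (@smooth_comp (fun s => f (c s)) (fun s => r * s)).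
  by have /curveP := cc; apply.
by apply: (smooth_ext _ (smooth_scal_r r)) => s; ring.
Qed.

Definition rescale (r : R) (c : curve_at) : curve_at :=
  exist _ (fun s => c (r * s)) (rescaleP r c).

(* r [c] = [s |-> c(r s)], computed on a chosen representative of the class; see
   [tscale_cls] for the independence of that choice. *)
Definition tscale (r : R) (v : tangent) : tangent := cls (rescale r (repr v)).

Lemma dir_deriv_tscale r v f :
  smooth_fun X f -> dir_deriv (tscale r v) f = r * dir_deriv v f.
Proof.
move=> Ff; rewrite dir_deriv_cls //= /dir_deriv.
set c := repr v.
rewrite (Derive_comp (fun s => f (c s)) (fun s => r * s)).
- rewrite Rmult_0_r; congr (_ * _); apply: is_derive_unique.
  by auto_derive => //; ring.
- have [/curveP/(_ _ Ff) sc _] := proj2_sig c.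
  exact: (sc 1%nat).
- by auto_derive.
Qed.

Lemma dir_deriv_inj (u v : tangent) :
  (forall f, smooth_fun X f -> dir_deriv u f = dir_deriv v f) -> u = v.
Proof. by move=> H; rewrite -(reprK u) -(reprK v); apply/clsP. Qed.

Lemma tscale_cls r (c : curve_at) : tscale r (cls c) = cls (rescale r c).
Proof.
apply: dir_deriv_inj => f Ff; rewrite dir_deriv_tscale // !dir_deriv_cls //=.
rewrite (Derive_comp (fun s => f (c s)) (fun s => r * s)).
- rewrite Rmult_0_r; congr (_ * _); symmetry; apply: is_derive_unique.
  by auto_derive => //; ring.
- have [/curveP/(_ _ Ff) sc _] := proj2_sig c.
  exact: (sc 1%nat).
- by auto_derive.
Qed.

Lemma dir_deriv_tzero f : smooth_fun X f -> dir_deriv tzero f = 0.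
Proof. by move=> Ff; rewrite dir_deriv_cls //= Derive_const. Qed.

Lemma tscale0 v : tscale 0 v = tzero.
Proof.
by apply: dir_deriv_inj => f Ff; rewrite dir_deriv_tscale // dir_deriv_tzero // Rmult_0_l.
Qed.
End TangentSpace.

Section TangentMap.
Variables (X Y : FrolicherSpace) (phi : X -> Y) (phiS : smooth_map phi).

Lemma push_curveP (x : X) (y : Y) (e : phi x = y) (c : curve_at x) :
  curve Y (fun s => phi (c s)) /\ phi (c 0) = y.
Proof. by case: c => c [cc c0] /=; split; [apply: phiS | rewrite c0]. Qed.

Definition push_curve (x : X) (y : Y) (e : phi x = y) (c : curve_at x) : curve_at y :=
  exist _ (fun s => phi (c s)) (push_curveP e c).

Definition tangent_map_at (x : X) (y : Y) (e : phi x = y) (v : tangent x) : tangent y :=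
  cls (push_curve e (repr v)).

Lemma tangent_map_at_cls (x : X) (y : Y) (e : phi x = y) (c : curve_at x) :
  tangent_map_at e (cls c) = cls (push_curve e c).
Proof.
apply/clsP => f Ff /=; apply: (@repr_cls _ _ c (fun a => f (phi a))).
apply/smooth_funP => d dc.
by have /curveP := phiS dc; apply.
Qed.

Definition tangent_map (p : {x : X & tangent x}) : {y : Y & tangent y} :=
  existT (fun y => tangent y) (phi (projT1 p)) (tangent_map_at erefl (projT2 p)).
End TangentMap.

(* The identification T R = R^2, [c] |-> (c(0), c'(0)). *)
Definition tangent_real (p : {x : real_line & tangent x}) : product real_line real_line :=
  (projT1 p, Derive (repr (projT2 p)) 0).

Definition tangent_bundle (X : FrolicherSpace) : FrolicherSpace :=
  @initial {x : X & tangent x} {f : X -> R | smooth_fun X f}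
    (fun _ => product real_line real_line)
    (fun f p => tangent_real (tangent_map (smooth_fun_map (proj2_sig f)) p)).

Definition tangent_space (X : FrolicherSpace) (x : X) : FrolicherSpace :=
  @initial (tangent x) unit (fun _ => tangent_bundle X)
    (fun _ v => existT (fun y : X => tangent y) x v).

Lemma tangent_space_curveP (X : FrolicherSpace) (x : X) (c : R -> tangent x) :
  curve (tangent_space x) c <->
  forall f, smooth_fun X f -> smooth (fun s => dir_deriv (c s) f).
Proof.
have E f (Ff : smooth_fun X f) s :
    Derive (repr (tangent_map_at (smooth_fun_map Ff) erefl (c s))) 0
    = dir_deriv (c s) f.
  exact: (@repr_cls real_line _ _ (fun r => r) smooth_id).
split=> [cc f Ff|H [] [f Ff] [|]] /=; last 2 first.
- exact: smooth_const.
- by apply: (smooth_ext _ (H f Ff)) => s; rewrite E.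
have /= := cc tt (exist _ f Ff) false.
by apply: smooth_ext => s; rewrite E.
Qed.

Section Xi.
Variables (X : FrolicherSpace) (x : X).

Lemma lineP (v : tangent x) :
  curve (tangent_space x) (fun s => tscale s v) /\ tscale 0 v = tzero x.
Proof.
split; last exact: tscale0.
apply/tangent_space_curveP => f Ff.
apply: (smooth_ext _ (smooth_scal_r (dir_deriv v f))) => s.
by rewrite dir_deriv_tscale.
Qed.

Definition line (v : tangent x) : @curve_at (tangent_space x) (tzero x) :=
  exist _ (fun s => tscale s v) (lineP v).

Definition Xi (v : tangent x) : @tangent (tangent_space x) (tzero x) := cls (line v).
End Xi.

Record FrolicherGroup := MkFrolicherGroup {
  abstract_group :> groupType;
  group_structure : FrolicherStructure abstract_group;
  group_space := MkFrolicherSpace group_structure;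
  mul_smooth : @smooth_map (product group_space group_space) group_space
    (fun p => (p.1 * p.2)%g);
  inv_smooth : @smooth_map group_space group_space (fun x => (x^-1)%g)
}.

Section LieAlgebraOfGroup.
Variable G : FrolicherGroup.
Local Notation S := (group_space G).

Definition lie_space : FrolicherSpace := @tangent_space S 1%g.

Lemma curve_mul (c d : R -> S) :
  curve S c -> curve S d -> curve S (fun s => (c s * d s)%g).
Proof. by move=> cc cd; apply: (mul_smooth (curve_pair cc cd)). Qed.

Lemma curve_inv (c : R -> S) : curve S c -> curve S (fun s => (c s)^-1%g).
Proof. exact: inv_smooth. Qed.

Lemma mul_curveP (c d : @curve_at S 1%g) :
  curve S (fun s => (c s * d s)%g) /\ (c 0 * d 0)%g = 1%g.
Proof.
case: c d => [c [cc c0]] [d [dc d0]] /=.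
by split; [apply: curve_mul | rewrite c0 d0 mulg1].
Qed.

Definition mul_curve (c d : @curve_at S 1%g) : @curve_at S 1%g :=
  exist _ (fun s => (c s * d s)%g) (mul_curveP c d).

(* [c] + [d] = [s |-> c(s) d(s)], computed on chosen representatives: that the
   class does not depend on them, and is the v + w of [is_lin_comb], is not
   formal and is not proved here. *)
Definition tadd (v w : lie_space) : lie_space := cls (mul_curve (repr v) (repr w)).

Lemma commutator_curveP (c d : @curve_at S 1%g) (s : R) :
  curve S (fun t => (c s * d t * (c s)^-1 * (d t)^-1)%g) /\
  (c s * d 0 * (c s)^-1 * (d 0)^-1)%g = 1%g.
Proof.
case: c d => [c [cc c0]] [d [dc d0]] /=; split.
  apply: (@curve_mul (fun t => (c s * d t * (c s)^-1)%g) (fun t => (d t)^-1%g)).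
    apply: (@curve_mul (fun t => (c s * d t)%g) (fun=> (c s)^-1%g)).
      exact: (@curve_mul (fun=> c s) d (curve_const (X := S) _) dc).
    exact: (curve_const (X := S)).
  exact: curve_inv.
by rewrite d0 invg1 !mulg1 mulgV.
Qed.

(* t |-> gamma(s, t) *)
Definition commutator_curve (c d : @curve_at S 1%g) (s : R) : @curve_at S 1%g :=
  exist _ (fun t => (c s * d t * (c s)^-1 * (d t)^-1)%g) (commutator_curveP c d s).

(* [v, w] = Xi^-1(xi), where xi = [s |-> [t |-> gamma(s, t)]] for any choice of
   representatives; that s |-> [t |-> gamma(s, t)] is a smooth curve through 0
   is part of the property. *)
Definition is_commutator_bracket (br : lie_space -> lie_space -> lie_space) : Prop :=
  forall c d : @curve_at S 1%g,
  exists xi : @curve_at lie_space (tzero (1%g : S)),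
    (forall s, xi s = cls (commutator_curve c d s)) /\ Xi (br (cls c) (cls d)) = cls xi.
End LieAlgebraOfGroup.

Record is_vector_space (V : Type) (zero : V) (add : V -> V -> V)
    (scale : R -> V -> V) : Prop := {
  vs_addA : forall u v w, add u (add v w) = add (add u v) w;
  vs_addC : forall u v, add u v = add v u;
  vs_add0 : forall u, add u zero = u;
  vs_addN : forall u, exists v, add u v = zero;
  vs_scaleA : forall a b u, scale a (scale b u) = scale (a * b) u;
  vs_scale1 : forall u, scale 1 u = u;
  vs_scaleDr : forall a u v, scale a (add u v) = add (scale a u) (scale a v);
  vs_scaleDl : forall a b u, scale (a + b) u = add (scale a u) (scale b u)
}.

Definition is_linear_map (V W : Type) (addV : V -> V -> V) (scaleV : R -> V -> V)
    (addW : W -> W -> W) (scaleW : R -> W -> W) (f : V -> W) : Prop :=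
  forall a u v, f (addV u (scaleV a v)) = addW (f u) (scaleW a (f v)).

Record is_lie_bracket (V : Type) (zero : V) (add : V -> V -> V)
    (scale : R -> V -> V) (br : V -> V -> V) : Prop := {
  lie_linear_l : forall w, is_linear_map add scale add scale (br^~ w);
  lie_linear_r : forall v, is_linear_map add scale add scale (br v);
  lie_alternating : forall v, br v v = zero;
  lie_jacobi : forall u v w,
    add (br u (br v w)) (add (br v (br w u)) (br w (br u v))) = zero
}.

Lemma group_morph1 (G H : groupType) (alpha : {multiplicative G -> H}) :
  alpha 1%g = 1%g.
Proof. by apply: (mulgI (alpha 1%g)); rewrite -gmulfM !mulg1. Qed.

Definition lie_map (G H : FrolicherGroup) (alpha : {multiplicative G -> H})
    (alphaS : @smooth_map (group_space G) (group_space H) alpha) :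
    lie_space G -> lie_space H :=
  tangent_map_at alphaS (group_morph1 alpha).

(* Main.v *)
(* If h : R^2 -> R is smooth along every smooth plane curve, then so are its
   partial derivatives (Boman): a gliding hump bounds the pure derivatives of h
   on boxes, and interpolation inequalities turn these bounds into geometric
   convergence of all derivatives of the difference quotients of h.  Hence such
   an h obeys the chain rule along the diagonal and the symmetry of mixed
   derivatives.

   Apply this to f(c(s) d(t)), whose mixed derivative at 0 is a bilinear form
   D_f(v, w) of v = [c] and w = [d].  As c(s)d(t) = gamma(s,t) d(t)c(s), the
   vector [v, w] differentiates f to D_f(v, w) - D_f(w, v).  Thus the bracket is
   a commutator of left-invariant operators, and the Jacobi identity is that of
   an associative algebra, read on the triple derivatives of f(a(s) b(r) c(t)). *)

Require Import Defs.
From Stdlib Require Import Reals Lra Lia Factorial.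
From Stdlib Require Import Classical ClassicalEpsilon FunctionalExtensionality.
From Coquelicot Require Import Coquelicot.
From mathcomp Require Import ssreflect ssrfun ssrbool monoid.

Set Implicit Arguments.
Unset Strict Implicit.
Unset Printing Implicit Defensive.

Local Open Scope R_scope.

(** * Smooth functions of one variable *)

Lemma smooth_plus (f g : R -> R) : smooth f -> smooth g -> smooth (fun x => f x + g x).
Proof.
by move=> /smoothP sf /smoothP sg; apply/smoothP => n; apply: diff_upto_plus.
Qed.

Lemma smooth_mult (f g : R -> R) : smooth f -> smooth g -> smooth (fun x => f x * g x).
Proof.
by move=> /smoothP sf /smoothP sg; apply/smoothP => n; apply: diff_upto_mult.
Qed.

Lemma smooth_minus (f g : R -> R) : smooth f -> smooth g -> smooth (fun x => f x - g x).
Proof.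
move=> sf sg; apply: (@smooth_ext (fun x => f x + (-1) * g x)) => [x|]; first ring.
by apply: smooth_plus => //; apply: smooth_mult => //; apply: smooth_const.
Qed.

Lemma smooth_affine (a b : R) : smooth (fun x => a + b * x).
Proof.
apply: smooth_plus; first exact: smooth_const.
by apply: smooth_mult; [exact: smooth_const | exact: smooth_id].
Qed.

Lemma diff_upto_inv n (f : R -> R) :
  (forall x, f x <> 0) -> diff_upto n f -> diff_upto n (fun x => / f x).
Proof.
move=> f0; elim: n => [|n IHn] // dfS; have dn := IHn (diff_upto_pred dfS).
case: dfS => /= df df'; split=> [x|]; first exact: ex_derive_inv.
apply: (@diff_upto_ext _ (fun x => (-1 * Derive f x) * (/ f x * / f x))).
  by move=> x; rewrite Derive_inv //; field.
apply: diff_upto_mult; last exact: diff_upto_mult.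
apply: diff_upto_mult => //.
by have /smoothP := smooth_const (-1); apply.
Qed.

Lemma smooth_inv (f : R -> R) :
  (forall x, f x <> 0) -> smooth f -> smooth (fun x => / f x).
Proof. by move=> f0 /smoothP sf; apply/smoothP => n; apply: diff_upto_inv. Qed.

Lemma smooth_ex_derive (f : R -> R) x : smooth f -> ex_derive f x.
Proof. by move=> sf; apply: (sf 1%nat). Qed.

Lemma smooth_Derive (f : R -> R) : smooth f -> smooth (Derive f).
Proof. by move=> /smoothP sf; apply/smoothP => n; have [] := sf (S n). Qed.

Lemma Derive_n_Derive (f : R -> R) n x : Derive_n (Derive f) n x = Derive_n f (S n) x.
Proof. by have := Derive_n_comp f n 1 x; rewrite Nat.add_1_r. Qed.

Lemma smooth_Derive_n (f : R -> R) n : smooth f -> smooth (Derive_n f n).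
Proof. by move=> sf; elim: n => [|n IHn] //=; apply: smooth_Derive. Qed.

Lemma smooth_continuous (f : R -> R) x : smooth f -> continuous f x.
Proof. by move=> sf; apply: ex_derive_continuous; apply: smooth_ex_derive. Qed.

Lemma smooth_continuity_pt (f : R -> R) x : smooth f -> continuity_pt f x.
Proof. by move=> sf; apply/continuity_pt_filterlim; apply: smooth_continuous. Qed.

Lemma Derive_n_smooth_minus (f g : R -> R) n x : smooth f -> smooth g ->
  Derive_n (fun y => f y - g y) n x = Derive_n f n x - Derive_n g n x.
Proof.
move=> sf sg; apply: Derive_n_minus; apply: filter_forall => y k _; first exact: sf.
exact: sg.
Qed.

Lemma Derive_n_smooth_plus (f g : R -> R) n x : smooth f -> smooth g ->
  Derive_n (fun y => f y + g y) n x = Derive_n f n x + Derive_n g n x.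
Proof.
move=> sf sg; apply: Derive_n_plus; apply: filter_forall => y k _; first exact: sf.
exact: sg.
Qed.

Lemma Derive_n_comp_affine (f : R -> R) a b n x : smooth f ->
  Derive_n (fun y => f (a * y + b)) n x = a ^ n * Derive_n f n (a * x + b).
Proof.
move=> sf.
rewrite (@Derive_n_comp_scal (fun y => f (y + b)) a n x); last first.
  apply: filter_forall => y k _; apply: ex_derive_n_comp_trans; exact: sf.
by rewrite Derive_n_comp_trans.
Qed.

Lemma smooth_bounded (f : R -> R) r : smooth f ->
  exists2 M, 0 <= M & forall x, Rabs x <= r -> Rabs (f x) <= M.
Proof.
move=> sf.
have [x _|M HM] := @bounded_continuity _ R_NormedModule f (- r) r.
  exact: smooth_continuous.
exists (Rmax 0 M) => [|x /Rabs_le_between hx]; first exact: Rmax_l.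
apply: Rle_trans (Rmax_r 0 M); apply: Rlt_le; exact: HM.
Qed.

(** * Geometric convergence and differentiation of limits *)

Lemma geom_half_lim (C : R) : is_lim_seq (fun n => C / 2 ^ n) 0.
Proof.
apply: (is_lim_seq_ext (fun n => C * (/ 2) ^ n)) => [n|].
  by rewrite pow_inv.
rewrite -(Rmult_0_r C); apply: (is_lim_seq_scal_l _ C 0).
by apply: is_lim_seq_geom; rewrite Rabs_pos_eq; lra.
Qed.

(** The bound is the exact partial sum of the geometric series; keeping its subtracted tail makes
    the induction on [m] close. *)
Lemma geom_cauchy_dist (u : nat -> R) C : (forall n, Rabs (u (S n) - u n) <= C / 2 ^ n) ->
  forall n m, Rabs (u (n + m)%nat - u n) <= 2 * C / 2 ^ n - 2 * C / 2 ^ (n + m).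
Proof.
move=> H n; elim=> [|m IHm].
  by rewrite Nat.add_0_r !Rminus_diag Rabs_R0; lra.
rewrite Nat.add_succ_r.
have -> : u (S (n + m)) - u n = (u (S (n + m)) - u (n + m)%nat) + (u (n + m)%nat - u n).
  ring.
apply: Rle_trans (Rabs_triang _ _) _.
have := H (n + m)%nat; rewrite /=.
have : 2 ^ (n + m) <> 0 by apply: pow_nonzero; lra.
move=> h.
have -> : 2 * C / (2 * 2 ^ (n + m)) = C / 2 ^ (n + m) by field.
lra.
Qed.

Lemma geom_cauchy_lim (u : nat -> R) C : (forall n, Rabs (u (S n) - u n) <= C / 2 ^ n) ->
  exists2 l : R, is_lim_seq u l & forall n, Rabs (u n - l) <= 2 * C / 2 ^ n.
Proof.
move=> H; have C0 : 0 <= C.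
  by have := H 0%nat; have := Rabs_pos (u 1%nat - u 0%nat); rewrite /=; lra.
have D n m : Rabs (u (n + m)%nat - u n) <= 2 * C / 2 ^ n.
  apply: Rle_trans (geom_cauchy_dist H n m) _.
  have : 0 <= 2 * C / 2 ^ (n + m); last lra.
  by apply: Rdiv_le_0_compat; [lra | apply: pow_lt; lra].
have [l Hl] : ex_finite_lim_seq u.
  apply/ex_lim_seq_cauchy_corr => eps.
  have [N HN] : exists N, 2 * C / 2 ^ N < eps / 2.
    have /is_lim_seq_spec/(_ (mkposreal _ (is_pos_div_2 eps))) := geom_half_lim (2 * C).
    case=> N /(_ N (le_n N)) /= HN; exists N.
    by move: HN; rewrite Rminus_0_r => /Rabs_lt_between; lra.
  exists N => n m hn hm.
  have := D N (n - N)%nat; have := D N (m - N)%nat.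
  rewrite !Nat.add_sub_assoc // ![(N + _)%nat]Nat.add_comm !Nat.add_sub 
    => /Rabs_le_between h1 /Rabs_le_between h2.
  by apply: Rabs_def1; lra.
exists l => // n; rewrite Rabs_minus_sym.
apply: (@is_lim_seq_le (fun m => Rabs (u (n + m)%nat - u n)) (fun=> 2 * C / 2 ^ n)
  (Rabs (l - u n)) (2 * C / 2 ^ n)) => //.
- apply: (is_lim_seq_abs _ (l - u n)); apply: is_lim_seq_minus'.
    apply: (is_lim_seq_ext (fun m => u (m + n)%nat)) => [m|]; first by rewrite Nat.add_comm.
    exact: (proj1 (is_lim_seq_incr_n u n l)).
  exact: is_lim_seq_const.
- exact: is_lim_seq_const.
Qed.
(** Uniform convergence of the first derivatives on bounded sets allows limit and derivative to be
    exchanged; the induction then passes to the sequence of derivatives and its limit. *)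
Lemma diff_upto_limit k (psi : nat -> R -> R) (g : R -> R) :
  (forall n, smooth (psi n)) ->
  (forall x, is_lim_seq (fun n => psi n x) (g x)) ->
  (forall j, (j <= k)%nat -> forall r, exists C, forall n x, Rabs x <= r ->
     Rabs (Derive_n (psi (S n)) j x - Derive_n (psi n) j x) <= C / 2 ^ n) ->
  diff_upto k g.
Proof.
elim: k psi g => [|k IHk] psi g // spsi lim_psi H.
pose l x := real (Lim_seq (fun n => Derive (psi n) x)).
have Hl r : exists C, forall x, Rabs x <= r ->
    is_lim_seq (fun n => Derive (psi n) x) (l x) /\
    forall n, Rabs (Derive (psi n) x - l x) <= 2 * C / 2 ^ n.
  have [C HC] := H 1%nat ltac:(lia) r; exists C => x hx.
  have [y Hy HCy] := @geom_cauchy_lim (fun n => Derive (psi n) x) C (fun n => HC n x hx).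
  by rewrite /l (is_lim_seq_unique _ _ Hy).
have dg x : is_derive g x (l x).
  (* [CVU_derivable] asks for uniform convergence on a ball; one centred at 0 fits the hypotheses,
     and this radius captures [x]. *)
  have r0 : 0 < Rabs x + 1 by have := Rabs_pos x; lra.
  have inB y : Boule 0 (mkposreal _ r0) y -> Rabs y <= Rabs x + 1.
    by rewrite /Boule /= Rminus_0_r; lra.
  have [C HC] := Hl (Rabs x + 1).
  apply/is_derive_Reals.
  apply: (@CVU_derivable psi (fun n => Derive (psi n)) g l 0 (mkposreal _ r0)).
  - move=> eps eps0.
    have /is_lim_seq_spec/(_ (mkposreal _ eps0)) := geom_half_lim (2 * C).
    case=> N HN; exists N => n y /HN /= hn /inB /HC [_ /(_ n)].
    rewrite Rabs_minus_sym => h; apply: Rle_lt_trans h _.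
    by move: hn; rewrite Rminus_0_r => /Rabs_lt_between; lra.
  - by move=> y _; apply/is_lim_seq_Reals.
  - by move=> n y _; apply/is_derive_Reals/Derive_correct/smooth_ex_derive.
  - by rewrite /Boule /= Rminus_0_r; lra.
split=> [x|]; first by exists (l x).
apply: (@diff_upto_ext _ l) => [x|]; first by symmetry; apply: is_derive_unique.
apply: (IHk (fun n => Derive (psi n))) => [n|x|j hj r].
- exact: smooth_Derive.
- by have [C /(_ x (Rle_refl _)) []] := Hl (Rabs x).
- have [C HC] := H (S j) ltac:(lia) r; exists C => n x hx.
  by rewrite !Derive_n_Derive; apply: HC.
Qed.

(** * Finite differences and interpolation between derivatives *)

Fixpoint fdiff (d : R) (k : nat) (f : R -> R) : R -> R :=
  if k is S k' then fdiff d k' (fun x => f (x + d) - f x) else f.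

Lemma smooth_shift (f : R -> R) d : smooth f -> smooth (fun x => f (x + d)).
Proof.
move=> sf; apply: (@smooth_comp f (fun x => x + d)) => //.
by apply: (smooth_ext _ (smooth_affine d 1)) => x; ring.
Qed.

(** An iterated mean value theorem: the induction hypothesis for f(x+d) - f(x) leaves an increment
    of the k-th derivative over [y, y+d], and one more mean value raises the order. *)
Lemma fdiff_mean_value d k f x : 0 <= d -> smooth f ->
  exists2 y, x <= y <= x + INR k * d & fdiff d k f x = d ^ k * Derive_n f k y.
Proof.
move=> d0; elim: k f => [|k IHk] f sf /=; first by exists x => /=; lra.
have [|y hy ->] := IHk (fun x => f (x + d) - f x).
  by apply: smooth_minus => //; apply: smooth_shift.
rewrite Derive_n_smooth_minus //; last exact: smooth_shift.
rewrite Derive_n_comp_trans.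
have [||z [hz ->]] := @MVT_gen (Derive_n f k) y (y + d) (Derive_n f (S k)).
- by move=> z _; apply: Derive_correct; apply: smooth_ex_derive; apply: smooth_Derive_n.
- by move=> z _; apply: smooth_continuity_pt; apply: smooth_Derive_n.
have -> : match k with 0%nat => 1 | S _ => INR k + 1 end = INR (S k) by [].
rewrite Rmin_left ?Rmax_right in hz; try lra.
exists z; first by rewrite S_INR; nra.
by rewrite /=; ring.
Qed.

Lemma fdiff_bound d k f x N : 0 <= d ->
  (forall y, x <= y <= x + INR k * d -> Rabs (f y) <= N) -> Rabs (fdiff d k f x) <= 2 ^ k * N.
Proof.
move=> d0; elim: k f N => [|k IHk] f N hN.
  by rewrite Rmult_1_l; apply: hN; rewrite /=; lra.
have kd : 0 <= INR k * d by apply: Rmult_le_pos => //; apply: pos_INR.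
have -> : 2 ^ S k * N = 2 ^ k * (N + N) by rewrite /=; ring.
apply: IHk => y hy; apply: Rle_trans (Rabs_triang _ _) _; rewrite Rabs_Ropp.
by apply: Rplus_le_compat; apply: hN; rewrite S_INR; lra.
Qed.

(** The k-th difference of step [d] yields a point [y] within k d of [x] where the k-th derivative
    is controlled by [N0]; moving from [y] back to [x] costs at most k d [N1]. *)
Lemma interpolation_step k f d r N0 N1 : smooth f -> 0 < d <= 1 ->
  (forall x, Rabs x <= r + INR k -> Rabs (f x) <= N0) ->
  (forall x, Rabs x <= r + INR k -> Rabs (Derive_n f (S k) x) <= N1) ->
  forall x, Rabs x <= r -> Rabs (Derive_n f k x) <= 2 ^ k * (N0 / d ^ k) + INR k * d * N1.
Proof.
move=> sf d01 h0 h1 x hx.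
have k0 := pos_INR k.
have inI y : x <= y <= x + INR k * d -> Rabs y <= r + INR k.
  by move: hx => /Rabs_le_between hx hy; apply/Rabs_le_between; nra.
have [|y hy Ey] := @fdiff_mean_value d k f x _ sf; first lra.
have := @fdiff_bound d k f x N0 ltac:(lra) (fun z hz => h0 z (inI z hz)).
have dk : 0 < d ^ k by apply: pow_lt; lra.
rewrite {}Ey Rabs_mult (Rabs_pos_eq (d ^ k)); last lra.
move=> hF.
have {}hF : Rabs (Derive_n f k y) <= 2 ^ k * (N0 / d ^ k).
  apply: (Rmult_le_reg_l (d ^ k)) => //.
  by have -> : d ^ k * (2 ^ k * (N0 / d ^ k)) = 2 ^ k * N0 by field; lra.
have [||z [hz Ez]] := @MVT_gen (Derive_n f k) x y (Derive_n f (S k)).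
- by move=> z _; apply: Derive_correct; apply: smooth_ex_derive; apply: smooth_Derive_n.
- by move=> z _; apply: smooth_continuity_pt; apply: smooth_Derive_n.
rewrite Rmin_left ?Rmax_right in hz; try lra.
have hz1 := h1 z (inI z ltac:(lra)).
have -> : Derive_n f k x = Derive_n f k y + - (Derive_n f (S k) z * (y - x)) by lra.
apply: Rle_trans (Rabs_triang _ _) _; rewrite Rabs_Ropp Rabs_mult (Rabs_pos_eq (y - x)); last lra.
have := Rabs_pos (Derive_n f (S k) z); nra.
Qed.

(** Order [k] is controlled by order k + 1 through [interpolation_step], and order k + 1 by
    induction on [j]. The constants [A] and [L] are fixed before [f] and [d], so the scale [d] may
    later vary along a sequence. *)
Lemma interpolation j k : exists A L : R, 0 <= A /\ 0 <= L /\
  forall f d r N0 N1, smooth f -> 0 < d <= 1 -> 0 <= N0 -> 0 <= N1 ->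
  (forall x, Rabs x <= r + L -> Rabs (f x) <= N0) ->
  (forall x, Rabs x <= r + L -> Rabs (Derive_n f (j + k) x) <= N1) ->
  forall x, Rabs x <= r -> Rabs (Derive_n f k x) <= A * (N0 / d ^ k + d ^ j * N1).
Proof.
elim: j k => [|j IHj] k.
  exists 1, 0; split; first lra; split; first lra.
  move=> f d r N0 N1 sf d01 N00 N10 h0 h1 x hx.
  have : 0 <= N0 / d ^ k by apply: Rdiv_le_0_compat => //; apply: pow_lt; lra.
  have := h1 x ltac:(lra); rewrite /=; lra.
have [A [L [A0 [L0 H]]]] := IHj (S k).
have k0 := pos_INR k.
have p0 : 0 <= 2 ^ k by apply: pow_le; lra.
exists (2 ^ k + INR k * A), (L + INR k).
have kA : 0 <= INR k * A by apply: Rmult_le_pos.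
split; first lra; split; first lra.
move=> f d r N0 N1 sf d01 N00 N10 h0 h1 x hx.
have dk : 0 < d ^ k by apply: pow_lt; lra.
apply: Rle_trans.
  apply: (@interpolation_step k f d r N0 (A * (N0 / d ^ S k + d ^ j * N1))) => //.
    by move=> y hy; apply: h0; lra.
  move=> y hy; apply: (H f d (r + INR k)) => // z hz; first by apply: h0; lra.
  by rewrite Nat.add_succ_r; apply: h1; lra.
(* The factor [d] gained in the step lowers one exponent and raises the other, which restores the
   shape of the claim. *)
have -> : INR k * d * (A * (N0 / d ^ S k + d ^ j * N1)) =
    INR k * A * (N0 / d ^ k + d ^ S j * N1).
  by rewrite /=; field; lra.
have : 0 <= d ^ S j * N1 by apply: Rmult_le_pos => //; apply: pow_le; lra.
have : 0 <= N0 / d ^ k by apply: Rdiv_le_0_compat.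
nra.
Qed.

(** * Flat functions and bumps *)

Definition flat (n : nat) (x : R) : R :=
  if Rlt_dec 0 x then exp (- / x) * (/ x) ^ n else 0.

Lemma flat_pos n x : 0 < x -> flat n x = exp (- / x) * (/ x) ^ n.
Proof. by rewrite /flat; case: Rlt_dec. Qed.

Lemma flat_neg n x : x <= 0 -> flat n x = 0.
Proof. by move=> x0; rewrite /flat; case: Rlt_dec => // ?; lra. Qed.

Lemma flat_gt0 n x : 0 < x -> 0 < flat n x.
Proof.
move=> x0; rewrite flat_pos //; apply: Rmult_lt_0_compat; first exact: exp_pos.
by apply: pow_lt; apply: Rinv_0_lt_compat.
Qed.

Lemma flat_ge0 n x : 0 <= flat n x.
Proof.
case: (Rlt_dec 0 x) => x0; last by rewrite flat_neg; lra.
by apply: Rlt_le; apply: flat_gt0.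
Qed.

(** With y = 1/x this is y^n / n! <= e^y, a single term of the exponential series. *)
Lemma flat_bounded n x : flat n x <= INR (fact n).
Proof.
case: (Rlt_dec 0 x) => x0; last by rewrite flat_neg; [exact: pos_INR | lra].
rewrite flat_pos //; have := Rinv_0_lt_compat _ x0; move: (/ x) => y y0.
have f0 : 0 < INR (fact n) by apply: INR_fact_lt_0.
have term0 k : 0 <= y ^ k / INR (fact k).
  by apply: Rdiv_le_0_compat; [apply: pow_le; lra | apply: INR_fact_lt_0].
have le_exp : y ^ n / INR (fact n) <= exp y.
  apply: Rle_trans (exp_ge_taylor y n (Rlt_le _ _ y0)).
  case: n {f0} => [|n] /=; first lra.
  have : 0 <= sum_f_R0 (fun k => y ^ k / INR (fact k)) n by apply: cond_pos_sum.
  rewrite /=; lra.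
rewrite exp_Ropp; have ey := exp_pos y.
apply: (Rmult_le_reg_l (exp y)) => //.
rewrite -Rmult_assoc Rinv_r ?Rmult_1_l; last lra.
apply: (Rmult_le_reg_r (/ INR (fact n))); first exact: Rinv_0_lt_compat.
by rewrite Rmult_assoc Rinv_r; lra.
Qed.

(** The powers of 1/x are carried along because the linear span of this family is closed under
    differentiation, so that all members are shown smooth at once. *)
Lemma is_derive_flat n x : is_derive (flat n) x (flat (S (S n)) x - INR n * flat (S n) x).
Proof.
have [x0|[->|x0]] := Rtotal_order x 0.
- rewrite !flat_neg; try lra.
  rewrite Rmult_0_r Rminus_0_r.
  apply: (is_derive_ext_loc (fun=> 0)); last exact: is_derive_const.
  exists (mkposreal (- x) ltac:(lra)) => y /Rabs_lt_between' /= hy.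
  by rewrite flat_neg //; lra.
- rewrite !flat_neg; try lra.
  rewrite Rmult_0_r Rminus_0_r; apply/is_derive_Reals => eps eps0.
  have c0 : 0 < INR (fact (S (S n))) by apply: INR_fact_lt_0.
  have d0 : 0 < eps / INR (fact (S (S n))) by apply: Rdiv_lt_0_compat.
  exists (mkposreal _ d0) => h h0 /= hd.
  rewrite Rplus_0_l (@flat_neg n 0); last lra.
  rewrite !Rminus_0_r.
  case: (Rlt_dec 0 h) => hp; last by rewrite flat_neg ?Rdiv_0_l ?Rabs_R0; lra.
  (* The difference quotient at 0 is thus at most (n+2)! h, whence the choice of radius. *)
  have -> : flat n h / h = flat (S (S n)) h * h by rewrite !flat_pos //=; field.
  rewrite Rabs_pos_eq in hd; last lra.
  rewrite Rabs_pos_eq; last by have := flat_ge0 (S (S n)) h; nra.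
  apply: (Rle_lt_trans _ (INR (fact (S (S n))) * h)).
    by apply: Rmult_le_compat_r; [lra | apply: flat_bounded].
  by have /(Rlt_div_r _ _ _ c0) := hd; lra.
- apply: (is_derive_ext_loc (fun x => exp (- / x) * (/ x) ^ n)).
    exists (mkposreal x x0) => y /Rabs_lt_between' /= hy.
    by rewrite flat_pos //; lra.
  rewrite !flat_pos //; auto_derive; first by split; lra.
  case: n => [|n]; first by rewrite /=; field; lra.
  by rewrite [Nat.pred _]/= -!/(pow _ _) -!tech_pow_Rmult; field; lra.
Qed.

Lemma smooth_flat n : smooth (flat n).
Proof.
apply/smoothP => m; elim: m n => [|m IHm] n //; split=> [x|].
  by eexists; apply: is_derive_flat.
apply: (@diff_upto_ext _ (fun x => flat (S (S n)) x + (- INR n) * flat (S n) x)) => [x|].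
  by rewrite (is_derive_unique _ _ _ (is_derive_flat n x)); ring.
apply: diff_upto_plus => //; apply: diff_upto_mult => //.
by have /smoothP := smooth_const (- INR n).
Qed.

Definition smooth_step (x : R) : R := flat 0 x / (flat 0 x + flat 0 (1 - x)).

Lemma smooth_step_den x : 0 < flat 0 x + flat 0 (1 - x).
Proof.
case: (Rlt_dec 0 x) => x0.
  by have := flat_gt0 0 x0; have := flat_ge0 0 (1 - x); lra.
by have := @flat_gt0 0 (1 - x) ltac:(lra); have := flat_ge0 0 x; lra.
Qed.

Lemma smooth_smooth_step : smooth smooth_step.
Proof.
have s1 : smooth (fun x => flat 0 (1 - x)).
  apply: (@smooth_comp (flat 0) (fun x => 1 - x)); first exact: smooth_flat.
  by apply: smooth_minus; [exact: smooth_const | exact: smooth_id].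
apply: smooth_mult; first exact: smooth_flat.
apply: smooth_inv => [x|]; first by have := smooth_step_den x; lra.
by apply: smooth_plus => //; apply: smooth_flat.
Qed.

Lemma smooth_step0 x : x <= 0 -> smooth_step x = 0.
Proof. by move=> x0; rewrite /smooth_step flat_neg // Rdiv_0_l. Qed.

Lemma smooth_step1 x : 1 <= x -> smooth_step x = 1.
Proof.
move=> x1; have := smooth_step_den x; rewrite /smooth_step (@flat_neg 0 (1 - x)); last lra.
by rewrite Rplus_0_r => h; field; lra.
Qed.

Definition bump (x : R) : R := smooth_step (2 + 2 * x) * smooth_step (2 + (- 2) * x).

Lemma smooth_bump : smooth bump.
Proof.
apply: smooth_mult; apply: (@smooth_comp smooth_step);
  by [apply: smooth_smooth_step | apply: smooth_affine].
Qed.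

Lemma bump1 x : Rabs x <= / 2 -> bump x = 1.
Proof. by move=> /Rabs_le_between hx; rewrite /bump !smooth_step1; lra. Qed.

Lemma bump0 x : 1 <= Rabs x -> bump x = 0.
Proof.
rewrite /bump /Rabs; case: Rcase_abs => h hx.
  by rewrite (@smooth_step0 (2 + 2 * x)); lra.
by rewrite (@smooth_step0 (2 + (-2) * x)); lra.
Qed.

(** On [-1, 1] the derivative is bounded by compactness; at any other point [f] vanishes in a
    neighbourhood. *)
Lemma Derive_n_supported_bounded (f : R -> R) j : smooth f ->
  (forall x, 1 <= Rabs x -> f x = 0) ->
  exists2 M, 0 <= M & forall x, Rabs (Derive_n f j x) <= M.
Proof.
move=> sf f0; have [M M0 HM] := smooth_bounded 1 (smooth_Derive_n j sf).
exists M => // x; case: (Rle_dec (Rabs x) 1) => hx; first exact: HM.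
rewrite (@Derive_n_ext_loc f (fun=> 0)).
  case: j {HM} => [|j]; first by rewrite /= Rabs_R0.
  by rewrite Derive_n_const Rabs_R0.
have d0 : 0 < Rabs x - 1 by lra.
exists (mkposreal _ d0) => y hy; apply: f0.
have : Rabs (x - y) < Rabs x - 1 by rewrite Rabs_minus_sym.
have := Rabs_triang_inv x y; lra.
Qed.

(** * Functions on the plane that are smooth along smooth curves *)

Section SpecialCurve.
Variables p q : nat -> R.
Hypothesis p_small : forall n, Rabs (p n) <= / 2 ^ (n * n).
Hypothesis q_small : forall n, Rabs (q n) <= / 2 ^ (n * n).

(** Equal to x near 0, it supplies the slope of an affine piece, as [bump] supplies its value. *)
Let id_bump (x : R) : R := x * bump x.

Let smooth_id_bump : smooth id_bump.
Proof. by apply: smooth_mult; [exact: smooth_id | exact: smooth_bump]. Qed.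

(* The argument of the bump is 2^(n+2) (u - 2^-n), so that the pieces have
   disjoint supports. *)
Let piece (n : nat) (u : R) : R :=
  p n * bump (2 ^ (n + 2) * u + - 4) +
  q n / 2 ^ (n + 2) * id_bump (2 ^ (n + 2) * u + - 4).

Fixpoint piece_sum (n : nat) (u : R) : R :=
  if n is S m then piece_sum m u + piece m u else 0.

Let pow2_gt0 n : 0 < 2 ^ n. Proof. by apply: pow_lt; lra. Qed.

Let smooth_dilate (f : R -> R) n : smooth f -> smooth (fun u => f (2 ^ n * u + - 4)).
Proof.
move=> sf; apply: (@smooth_comp f (fun u => 2 ^ n * u + - 4)) => //.
by apply: (smooth_ext _ (smooth_affine (-4) (2 ^ n))) => u; ring.
Qed.

Let smooth_piece n : smooth (piece n).
Proof.
apply: smooth_plus; apply: smooth_mult; try exact: smooth_const.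
  exact: smooth_dilate smooth_bump.
exact: smooth_dilate smooth_id_bump.
Qed.

Let smooth_piece_sum n : smooth (piece_sum n).
Proof. by elim: n => [|n IHn] /=; [exact: smooth_const | exact: smooth_plus]. Qed.

(** Dilation costs a factor 2^((n+2)j), which the decay 2^(-n^2) of the coefficients outweighs. *)
Let Derive_n_piece j : exists C, forall n u, Rabs (Derive_n (piece n) j u) <= C / 2 ^ n.
Proof.
have [M M0 HM] := Derive_n_supported_bounded j smooth_bump bump0.
have [M' M'0 HM'] := @Derive_n_supported_bounded id_bump j smooth_id_bump
  (fun x hx => etrans (f_equal (Rmult x) (bump0 hx)) (Rmult_0_r x)).
(* The exponent comes from n(j+1) <= n^2 + (j+1)^2, that is, (n+2)j + n <= 2j + (j+1)^2 + n^2. *)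
exists ((M + M') * 2 ^ (2 * j + (j + 1) * (j + 1))) => n u.
have -> : Derive_n (piece n) j u =
    p n * ((2 ^ (n + 2)) ^ j * Derive_n bump j (2 ^ (n + 2) * u + - 4)) +
    q n / 2 ^ (n + 2) * ((2 ^ (n + 2)) ^ j * Derive_n id_bump j (2 ^ (n + 2) * u + - 4)).
  rewrite /piece Derive_n_smooth_plus.
  - rewrite !Derive_n_scal_l Derive_n_comp_affine; last exact: smooth_bump.
    by rewrite Derive_n_comp_affine.
  - apply: smooth_mult; [exact: smooth_const | exact: smooth_dilate smooth_bump].
  - apply: smooth_mult; [exact: smooth_const | exact: smooth_dilate smooth_id_bump].
rewrite -pow_mult; move: (2 ^ (n + 2) * u + - 4) => w.
have key : 2 ^ ((n + 2) * j) * / 2 ^ (n * n) <= 2 ^ (2 * j + (j + 1) * (j + 1)) / 2 ^ n.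
  have n20 := pow2_gt0 (n * n); have n0 := pow2_gt0 n.
  apply/(Rle_div_l _ _ _ n20)/(Rmult_le_reg_r (2 ^ n)) => //.
  have -> : 2 ^ (2 * j + (j + 1) * (j + 1)) / 2 ^ n * 2 ^ (n * n) * 2 ^ n =
            2 ^ (2 * j + (j + 1) * (j + 1)) * 2 ^ (n * n) by field; lra.
  rewrite -!pow_add; apply: Rle_pow; [lra | nia].
have A0 := pow2_gt0 ((n + 2) * j); have B0 : 0 < / 2 ^ (n * n) by apply: Rinv_0_lt_compat.
have term x y m : Rabs x <= / 2 ^ (n * n) -> 0 <= m -> Rabs y <= m ->
    Rabs (x * (2 ^ ((n + 2) * j) * y)) <= 2 ^ ((n + 2) * j) * / 2 ^ (n * n) * m.
  move=> hx m0 hy; rewrite !Rabs_mult (Rabs_pos_eq (2 ^ _)); last lra.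
  have -> : 2 ^ ((n + 2) * j) * / 2 ^ (n * n) * m = / 2 ^ (n * n) * (2 ^ ((n + 2) * j) * m) by ring.
  apply: Rmult_le_compat => //; try exact: Rabs_pos.
    by apply: Rmult_le_pos; [lra | exact: Rabs_pos].
  by apply: Rmult_le_compat_l => //; lra.
have hq : Rabs (q n / 2 ^ (n + 2)) <= / 2 ^ (n * n).
  apply: Rle_trans (q_small n); have n2 := pow2_gt0 (n + 2).
  rewrite /Rdiv Rabs_mult (Rabs_pos_eq (/ _)); last by apply: Rlt_le; apply: Rinv_0_lt_compat.
  apply/(Rle_div_l _ _ _ n2); have := @pow_R1_Rle 2 (n + 2) ltac:(lra).
  have := Rabs_pos (q n); nra.
apply: Rle_trans (Rabs_triang _ _) _.
apply: Rle_trans (Rplus_le_compat _ _ _ _ (term _ _ M (p_small n) M0 (HM w))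
                                          (term _ _ M' hq M'0 (HM' w))) _.
rewrite -Rmult_plus_distr_l Rmult_comm /Rdiv (Rmult_assoc (M + M')).
by apply: Rmult_le_compat_l => //; lra.
Qed.

Let piece_on n u : Rabs (u - / 2 ^ n) <= / 2 ^ (n + 3) ->
  piece n u = p n + q n * (u - / 2 ^ n).
Proof.
move=> hu; have n0 := pow2_gt0 n; rewrite /piece /id_bump !bump1.
  by rewrite pow_add; field; lra.
have -> : 2 ^ (n + 2) * u + - 4 = 2 ^ (n + 2) * (u - / 2 ^ n) by rewrite pow_add; field; lra.
rewrite Rabs_mult Rabs_pos_eq; last exact: Rlt_le.
apply: (Rle_trans _ (2 ^ (n + 2) * / 2 ^ (n + 3))).
  by apply: Rmult_le_compat_l => //; apply: Rlt_le.
by right; rewrite !pow_add; field; lra.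
Qed.

Let piece_off i n u : i <> n -> Rabs (u - / 2 ^ n) <= / 2 ^ (n + 3) -> piece i u = 0.
Proof.
move=> ne /Rabs_le_between'; have n0 := pow2_gt0 n; have i0 := pow2_gt0 i.
rewrite pow_add => hu.
(* Hence 2^i u is at most 9/16 for i < n and at least 7/4 for i > n; either way 4 * 2^i u - 4 has
   absolute value at least 1, outside the support of [bump]. *)
have {}hu : 7 / 8 <= 2 ^ n * u <= 9 / 8.
  have e1 : 2 ^ n * / 2 ^ n = 1 by field; lra.
  have e2 : 2 ^ n * / (2 ^ n * 2 ^ 3) = / 8 by field; lra.
  split.
    apply: (Rle_trans _ (2 ^ n * (/ 2 ^ n - / (2 ^ n * 2 ^ 3)))); last nra.
    by rewrite Rmult_minus_distr_l e1 e2; lra.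
  apply: (Rle_trans _ (2 ^ n * (/ 2 ^ n + / (2 ^ n * 2 ^ 3)))); first nra.
  by rewrite Rmult_plus_distr_l e1 e2; lra.
suff hw : 1 <= Rabs (2 ^ (i + 2) * u + - 4).
  by rewrite /piece /id_bump bump0 //; ring.
rewrite pow_add -/(pow 2 2).
have u0 : 0 < u by nra.
have /Nat.lt_gt_cases[lt_in|lt_ni] := ne.
  have : 2 * 2 ^ i <= 2 ^ n by apply: (@Rle_pow 2 (S i)); [lra | lia].
  move=> /(Rmult_le_compat_r u _ _ (Rlt_le _ _ u0)) h.
  by rewrite -Rabs_Ropp Rabs_pos_eq /=; lra.
have : 2 * 2 ^ n <= 2 ^ i by apply: (@Rle_pow 2 (S n)); [lra | lia].
move=> /(Rmult_le_compat_r u _ _ (Rlt_le _ _ u0)) h.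
by rewrite Rabs_pos_eq /=; lra.
Qed.

(** The curve is the sum of all pieces: its partial sums converge geometrically with every
    derivative, and near 2^-n only the n-th piece is nonzero. *)
Lemma special_curve : exists2 c : R -> R, smooth c &
  forall n u, Rabs (u - / 2 ^ n) <= / 2 ^ (n + 3) -> c u = p n + q n * (u - / 2 ^ n).
Proof.
have step j n u : Derive_n (piece_sum (S n)) j u - Derive_n (piece_sum n) j u =
    Derive_n (piece n) j u.
  by rewrite (_ : piece_sum (S n) = fun u => piece_sum n u + piece n u) // Derive_n_smooth_plus //; ring.
have lim u : is_lim_seq (piece_sum^~ u) (real (Lim_seq (piece_sum^~ u))).
  have [C HC] := Derive_n_piece 0.
  have [|l Hl _] := @geom_cauchy_lim (piece_sum^~ u) C; last by rewrite (is_lim_seq_unique _ _ Hl).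
  by move=> n; have /= -> := step 0%nat n u; apply: HC.
exists (fun u => real (Lim_seq (piece_sum^~ u))) => [|n u hu].
  apply/smoothP => k; apply: (@diff_upto_limit k piece_sum) => // j _ r.
  by have [C HC] := Derive_n_piece j; exists C => n x _; rewrite step; apply: HC.
have sum0 m : (m <= n)%nat -> piece_sum m u = 0.
  elim: m => [|m IHm] hm //=; rewrite IHm; last lia.
  by rewrite (piece_off _ hu) ?Rplus_0_r //; lia.
have sum1 m : piece_sum (m + S n) u = p n + q n * (u - / 2 ^ n).
  elim: m => [|m IHm] /=; first by rewrite sum0 // Rplus_0_l; apply: piece_on.
  by rewrite IHm (piece_off _ hu) ?Rplus_0_r //; lia.
have /(is_lim_seq_incr_n _ (S n)) := lim u => h.
have := is_lim_seq_unique _ _ (is_lim_seq_ext _ _ _ sum1 h).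
by rewrite Lim_seq_const => -[].
Qed.
End SpecialCurve.

(** * Bounds on pure derivatives *)

Definition smooth2 (h : R -> R -> R) : Prop :=
  forall a b, smooth a -> smooth b -> smooth (fun u => h (a u) (b u)).

Lemma smooth2_l h t : smooth2 h -> smooth (h^~ t).
Proof. by move=> sh; apply: (sh (fun s => s) (fun=> t));
  [exact: smooth_id | exact: smooth_const]. Qed.

Lemma smooth2_r h s : smooth2 h -> smooth (h s).
Proof. by move=> sh; apply: (sh (fun=> s) (fun t => t));
  [exact: smooth_const | exact: smooth_id]. Qed.

(* Otherwise a special curve runs with speed 2^(-n^2) through horizontal segments
   at points tending to (s0, t0), and the k-th derivative of h along it is
   unbounded near 0. *)
Lemma Derive_n_smooth2_locally_bounded h k s0 t0 : smooth2 h -> exists n, forall s t,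
  Rabs (s - s0) <= / 2 ^ (n * n) -> Rabs (t - t0) <= / 2 ^ (n * n) ->
  Rabs (Derive_n (h^~ t) k s) <= INR n * (2 ^ (n * n)) ^ k.
Proof.
move=> sh; apply: NNPP => no.
have bad n : {st : R * R | (Rabs (st.1 - s0) <= / 2 ^ (n * n) /\ Rabs (st.2 - t0) <= / 2 ^ (n * n))
    /\ INR n * (2 ^ (n * n)) ^ k < Rabs (Derive_n (h^~ st.2) k st.1)}.
  apply: constructive_indefinite_description; apply: NNPP => none.
  apply: no; exists n => s t hs ht; apply: Rnot_lt_le => hlt.
  by apply: none; exists (s, t).
pose s n := (proj1_sig (bad n)).1; pose t n := (proj1_sig (bad n)).2.
have pow2_gt0 n : 0 < 2 ^ n by apply: pow_lt; lra.
have inv2_ge0 n : 0 <= / 2 ^ n by apply: Rlt_le; apply: Rinv_0_lt_compat.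
have [||c1 sc1 Hc1] := @special_curve (fun n => s n - s0) (fun n => / 2 ^ (n * n)).
- by move=> n; have [[]] := proj2_sig (bad n).
- by move=> n; rewrite Rabs_pos_eq //; lra.
have [||c2 sc2 Hc2] := @special_curve (fun n => t n - t0) (fun=> 0).
- by move=> n; have [[]] := proj2_sig (bad n).
- by move=> n; rewrite Rabs_R0.
have sF : smooth (fun u => h (s0 + c1 u) (t0 + c2 u)).
  by apply: (sh (fun u => s0 + c1 u) (fun u => t0 + c2 u)); apply: smooth_plus => //; apply: smooth_const.
have [M M0 HM] := smooth_bounded 1 (smooth_Derive_n k sF).
have [N HN] := INR_unbounded M.
have [[hs ht] hN] := proj2_sig (bad N).
(* Near 2^-N the composite is a horizontal slice of [h] run at speed 2^(-N^2). The k-th power of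
   this speed cancels the factor in the assumed lower bound, leaving a derivative larger than N >
   M. *)
have near_N : Derive_n (fun u => h (s0 + c1 u) (t0 + c2 u)) k (/ 2 ^ N) =
    (/ 2 ^ (N * N)) ^ k * Derive_n (h^~ (t N)) k (s N).
  rewrite (@Derive_n_ext_loc _
    (fun u => h (/ 2 ^ (N * N) * u + (s N - / 2 ^ (N * N) * / 2 ^ N)) (t N))).
    rewrite (@Derive_n_comp_affine (h^~ (t N))); last exact: smooth2_l.
    by congr (_ * Derive_n _ _ _); ring.
  have d0 : 0 < / 2 ^ (N + 3) by apply: Rinv_0_lt_compat.
  exists (mkposreal _ d0) => u hu.
  have {}hu := Rlt_le _ _ hu; rewrite (Hc1 N) // (Hc2 N) //.
  by congr (h _ _); ring.
have N1 : Rabs (/ 2 ^ N) <= 1.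
  rewrite Rabs_pos_eq // -Rinv_1; apply: Rinv_le_contravar; first lra.
  by apply: pow_R1_Rle; lra.
have H := HM _ N1; rewrite near_N Rabs_mult pow_inv in H.
have p0 : 0 < (2 ^ (N * N)) ^ k by apply: pow_lt.
rewrite Rabs_pos_eq in H; last by apply: Rlt_le; apply: Rinv_0_lt_compat.
move: hN; rewrite -/(s N) -/(t N) => hN.
have : INR N < / (2 ^ (N * N)) ^ k * Rabs (Derive_n (h^~ (t N)) k (s N)).
  apply: (Rmult_lt_reg_r ((2 ^ (N * N)) ^ k)) => //.
  by rewrite (Rmult_comm (/ _)) Rmult_assoc Rinv_l ?Rmult_1_r //; lra.
lra.
Qed.

Lemma Derive_n_smooth2_bounded h k r : smooth2 h -> exists M, forall s t,
  Rabs s <= r -> Rabs t <= r -> Rabs (Derive_n (h^~ t) k s) <= M.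
Proof.
move=> sh.
pose P s0 t0 n := forall s t,
  Rabs (s - s0) <= / 2 ^ (n * n) -> Rabs (t - t0) <= / 2 ^ (n * n) ->
  Rabs (Derive_n (h^~ t) k s) <= INR n * (2 ^ (n * n)) ^ k.
have loc s0 t0 : {n | P s0 t0 n}.
  by apply: constructive_indefinite_description; apply: Derive_n_smooth2_locally_bounded.
(* [B] dominates both the local bound and the inverse of the local radius, so the gauge 1/[B] serves
   for both: a compactness constant [d] below it gives the global bound 1/[d]. *)
pose B s0 t0 := let n := proj1_sig (loc s0 t0) in INR n * (2 ^ (n * n)) ^ k + 2 ^ (n * n).
have pow2_gt0 n : 0 < 2 ^ n by apply: pow_lt; lra.
have C0 (n : nat) : 0 <= INR n * (2 ^ (n * n)) ^ k.
  by apply: Rmult_le_pos; [exact: pos_INR | apply: Rlt_le; apply: pow_lt].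
have B0 s0 t0 : 0 < / B s0 t0.
  apply: Rinv_0_lt_compat; rewrite /B; case: (loc s0 t0) => n _ /=.
  by have := C0 n; have := pow2_gt0 (n * n)%nat; lra.
have [d Hd] := compactness_value_2d (- r) r (- r) r (fun s t => mkposreal _ (B0 s t)).
exists (/ d) => s t /Rabs_le_between hs /Rabs_le_between ht; apply: Rnot_lt_le => hlt.
apply: (Hd s t hs ht) => -[u [v [_ [_ /=]]]].
rewrite /B; case: (loc u v) => n Hn /= [hu [hv hd]].
have c0 := C0 n; have p0 := pow2_gt0 (n * n)%nat.
have le_inv : / (INR n * (2 ^ (n * n)) ^ k + 2 ^ (n * n)) <= / 2 ^ (n * n).
  by apply: Rinv_le_contravar; lra.
have := Hn s t ltac:(lra) ltac:(lra).
have : INR n * (2 ^ (n * n)) ^ k + 2 ^ (n * n) <= / d.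
  rewrite -(Rinv_inv (_ + _)); apply: Rinv_le_contravar => //; exact: cond_pos.
lra.
Qed.

Lemma smooth2_swap h : smooth2 h -> smooth2 (fun s t => h t s).
Proof. by move=> sh a b sa sb; apply: (sh b a). Qed.

(** * Smoothness of partial derivatives *)

Lemma smooth_mean_value (f : R -> R) a b : smooth f ->
  exists2 c, Rmin a b <= c <= Rmax a b & f b - f a = Derive f c * (b - a).
Proof.
move=> sf; have [||c [hc E]] := @MVT_gen f a b (Derive f); last by exists c.
  by move=> x _; apply: Derive_correct; apply: smooth_ex_derive.
by move=> x _; apply: smooth_continuity_pt.
Qed.

(** Two mean values: the quotient is the partial derivative at some c in [0, t], and its distance to
    the value at 0 is c times a second derivative, bounded on a box. *)
Lemma diff_quotient_bound h r : smooth2 h -> exists2 M, 0 <= M & forall s t,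
  Rabs s <= r -> 0 < t <= 1 -> Rabs ((h s t - h s 0) / t - Derive (h s) 0) <= M * t.
Proof.
move=> sh; have [M HM] := Derive_n_smooth2_bounded 2 (Rmax r 1) (smooth2_swap sh).
exists (Rabs M) => [|s t hs t01]; first exact: Rabs_pos.
have sd := smooth2_r s sh.
have [c hc ->] := smooth_mean_value 0 t sd.
rewrite Rmin_left ?Rmax_right in hc; try lra.
have -> : Derive (h s) c * (t - 0) / t = Derive (h s) c by field; lra.
have [e he ->] := smooth_mean_value 0 c (smooth_Derive sd).
rewrite Rmin_left ?Rmax_right in he; try lra.
rewrite Rminus_0_r Rabs_mult (Rabs_pos_eq c); last lra.
apply: Rmult_le_compat; [exact: Rabs_pos | lra | | lra].
apply: Rle_trans (Rle_abs M); apply: (HM e s).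
  by rewrite Rabs_pos_eq; [apply: Rle_trans (Rmax_r _ _); lra | lra].
by apply: Rle_trans (Rmax_l _ _).
Qed.

(* The difference quotients at step tau_n = 2^-(n(k+1)) converge at rate tau_n,
   whereas each of their derivatives is O(1 / tau_n); interpolating at scale 2^-n
   between the orders 0 and k + 2 + i makes the i-th derivatives, i <= k, converge
   at rate 2^-n. *)
Lemma smooth_partial_0 h : smooth2 h -> smooth (fun s => Derive (h s) 0).
Proof.
move=> sh; apply/smoothP => k.
pose tau n := / 2 ^ (n * (k + 1)).
have pow2_gt0 n : 0 < 2 ^ n by apply: pow_lt; lra.
have pow2_ge1 n : 1 <= 2 ^ n by apply: pow_R1_Rle; lra.
have tau01 n : 0 < tau n <= 1.
  split; first exact: Rinv_0_lt_compat.
  by rewrite -Rinv_1; apply: Rinv_le_contravar; [lra | ].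
have tau_decr n : tau (S n) <= tau n.
  by apply: Rinv_le_contravar => //; apply: Rle_pow; [lra | nia].
pose psi n s := (h s (tau n) - h s 0) / tau n.
have spsi n : smooth (psi n).
  apply: (@smooth_ext (fun s => / tau n * (h s (tau n) - h s 0))) => [s|].
    by rewrite /psi Rmult_comm.
  by apply: smooth_mult; [exact: smooth_const | apply: smooth_minus; apply: smooth2_l].
have Dpsi j n s : Derive_n (psi n) j s =
    / tau n * (Derive_n (h^~ (tau n)) j s - Derive_n (h^~ 0) j s).
  rewrite (@Derive_n_ext _ (fun s => / tau n * (h s (tau n) - h s 0))).
    by rewrite Derive_n_scal_l Derive_n_smooth_minus //; apply: smooth2_l.
  by move=> x; rewrite /psi Rmult_comm.
apply: (@diff_upto_limit k psi) => // [s|i hi r].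
  have [M M0 HM] := diff_quotient_bound (Rabs s) sh.
  apply/is_lim_seq_spec => eps.
  have /is_lim_seq_spec/(_ eps) := geom_half_lim M; case=> N HN.
  exists N => n /HN; rewrite Rminus_0_r => /Rabs_lt_between hn.
  apply: Rle_lt_trans (HM s (tau n) (Rle_refl _) (tau01 n)) _.
  apply: (Rle_lt_trans _ (M / 2 ^ n)); last lra.
  apply: Rmult_le_compat_l => //; apply: Rinv_le_contravar => //.
  by apply: Rle_pow; [lra | nia].
have [A [L [A0 [L0 HA]]]] := interpolation (k + 2) i.
have [M M0 HM] := diff_quotient_bound (r + L) sh.
have [M' HM'] := Derive_n_smooth2_bounded (k + 2 + i) (Rmax (r + L) 1) sh.
(* At scale 2^-n the two interpolation terms are 2M tau_n 2^(ni), at most 2M / 2^n since i <= k, and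
   2^(-n(k+2)) 4|M'| / tau_(n+1), equal to 2^(k+1) 4|M'| / 2^n. *)
exists (A * (2 * M + 2 ^ (k + 1) * (4 * Rabs M'))) => n x hx.
have d01 : 0 < / 2 ^ n <= 1.
  split; first exact: Rinv_0_lt_compat.
  by rewrite -Rinv_1; apply: Rinv_le_contravar; [lra | ].
have M'0 := Rabs_pos M'.
have tn := tau01 n; have tSn := tau01 (S n); have tdec := tau_decr n.
have itn : 0 < / tau (S n) by apply: Rinv_0_lt_compat; lra.
have N00 : 0 <= 2 * M * tau n by nra.
have N10 : 0 <= 4 * Rabs M' * / tau (S n) by nra.
have sphi : smooth (fun y => psi (S n) y - psi n y) by apply: smooth_minus.
have := HA _ (/ 2 ^ n) r _ _ sphi d01 N00 N10.
rewrite -Derive_n_smooth_minus // => /(_ _ _ x hx) H.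
apply: Rle_trans (H _ _) _ => [y hy|y hy|].
- have := HM y _ hy tn; have := HM y _ hy tSn => /Rabs_le_between h1 /Rabs_le_between h2.
  by apply/Rabs_le_between; rewrite /psi; nra.
- have hy' : Rabs y <= Rmax (r + L) 1 by apply: Rle_trans (Rmax_l _ _).
  have bd t : 0 <= t <= 1 -> Rabs (Derive_n (h^~ t) (k + 2 + i) y) <= Rabs M'.
    move=> ht; apply: Rle_trans (Rle_abs M'); apply: HM' => //.
    by rewrite Rabs_pos_eq; [apply: Rle_trans (Rmax_r _ _); lra | lra].
  rewrite Derive_n_smooth_minus // !Dpsi.
  have b0 := bd 0 ltac:(lra); have b1 := bd _ (conj (Rlt_le _ _ (proj1 tn)) (proj2 tn)).
  have b2 := bd _ (conj (Rlt_le _ _ (proj1 tSn)) (proj2 tSn)).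
  have ile : / tau n <= / tau (S n) by apply: Rinv_le_contravar; lra.
  have itn0 : 0 < / tau n by apply: Rinv_0_lt_compat; lra.
  have term p q z : Rabs p <= Rabs M' -> Rabs q <= Rabs M' -> 0 < z <= / tau (S n) ->
      Rabs (z * (p - q)) <= 2 * Rabs M' * / tau (S n).
    move=> hp hq hz; rewrite Rabs_mult (Rabs_pos_eq z); last lra.
    rewrite Rmult_comm; apply: Rmult_le_compat; try lra; first exact: Rabs_pos.
    by apply: Rle_trans (Rabs_triang _ _) _; rewrite Rabs_Ropp; lra.
  apply: Rle_trans (Rabs_triang _ _) _; rewrite Rabs_Ropp.
  have := term _ _ _ b1 b0 (conj itn0 ile).
  have := term _ _ _ b2 b0 (conj itn (Rle_refl _)); lra.
- rewrite /Rdiv (Rmult_assoc A); apply: Rmult_le_compat_l => //.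
  rewrite Rmult_plus_distr_r; apply: Rplus_le_compat.
    rewrite Rmult_assoc; apply: Rmult_le_compat_l; first lra.
    rewrite pow_inv Rinv_inv -pow_mult /tau Rmult_comm.
    have n0 := pow2_gt0 n; have a0 := pow2_gt0 (n * (k + 1))%nat.
    apply: (Rmult_le_reg_r (2 ^ n)) => //; apply: (Rmult_le_reg_r (2 ^ (n * (k + 1)))) => //.
    have -> : 2 ^ (n * i) * / 2 ^ (n * (k + 1)) * 2 ^ n * 2 ^ (n * (k + 1)) =
       2 ^ (n * i) * 2 ^ n by field; lra.
    have -> : / 2 ^ n * 2 ^ n * 2 ^ (n * (k + 1)) = 2 ^ (n * (k + 1)) by field; lra.
    rewrite -pow_add; apply: Rle_pow; [lra | nia].
  rewrite pow_inv -pow_mult /tau Rinv_inv.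
  have -> : (S n * (k + 1) = n * (k + 1) + (k + 1))%nat by lia.
  have -> : (n * (k + 2) = n * (k + 1) + n)%nat by lia.
  rewrite !pow_add; right; field.
  have := pow2_gt0 n; have := pow2_gt0 (n * (k + 1))%nat; lra.
Qed.

(** Along a curve (a, b), translating the second variable by b(u) moves the point of differentiation
    to 0, where [smooth_partial_0] applies. *)
Lemma smooth2_partial_r h : smooth2 h -> smooth2 (fun s t => Derive (h s) t).
Proof.
move=> sh a b sa sb.
apply: (@smooth_ext (fun u => Derive (fun t => h (a u) (t + b u)) 0)) => [u|].
  by have := Derive_n_comp_trans (h (a u)) 1 0 (b u); rewrite /= Rplus_0_l.
apply: (@smooth_partial_0 (fun u t => h (a u) (t + b u))) => c d sc sd.
apply: (sh (fun v => a (c v)) (fun v => d v + b (c v))); first exact: smooth_comp.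
by apply: smooth_plus => //; apply: smooth_comp.
Qed.

Lemma smooth2_partial_l h : smooth2 h -> smooth2 (fun s t => Derive (h^~ t) s).
Proof. by move=> /smooth2_swap/smooth2_partial_r/smooth2_swap. Qed.

(** * Joint continuity, the diagonal chain rule and symmetry of mixed derivatives *)

Lemma smooth2_continuity h x y : smooth2 h -> continuity_2d_pt h x y.
Proof.
move=> sh; pose r := Rabs x + Rabs y + 1.
have x0 := Rabs_pos x; have y0 := Rabs_pos y.
have [M HM] := Derive_n_smooth2_bounded 1 r sh.
have [M' HM'] := Derive_n_smooth2_bounded 1 r (smooth2_swap sh).
pose K := Rabs M + Rabs M' + 1; have K0 : 0 < K.
  by rewrite /K; have := Rabs_pos M; have := Rabs_pos M'; lra.
move=> eps; have e0 := cond_pos eps.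
have d0 : 0 < Rmin 1 (eps / K) by apply: Rmin_pos; [lra | apply: Rdiv_lt_0_compat].
exists (mkposreal _ d0) => u v /= hu hv.
have := Rmin_l 1 (eps / K); have := Rmin_r 1 (eps / K) => m1 m2.
have near_le a b : Rabs (a - b) <= 1 -> forall c, Rmin a b <= c <= Rmax a b ->
    Rabs c <= Rabs b + 1.
  move=> hab c [hc1 hc2]; have hc : Rabs (c - b) <= Rabs (a - b) by apply: Rabs_le_between_min_max.
  by have := Rabs_triang (c - b) b; rewrite (_ : c - b + b = c); [lra | ring].
have [c hc Ec] := smooth_mean_value x u (smooth2_l v sh).
have [e he Ee] := smooth_mean_value y v (smooth2_r x sh).
rewrite Rmin_comm Rmax_comm in hc; rewrite Rmin_comm Rmax_comm in he.
have bc : Rabs (Derive (h^~ v) c) <= Rabs M.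
  apply: Rle_trans (Rle_abs M); apply: (HM c v).
    by have := near_le u x ltac:(lra) c hc; rewrite /r; lra.
  have := near_le v y ltac:(lra) v (conj (Rmin_l _ _) (Rmax_l _ _)); rewrite /r; lra.
have be : Rabs (Derive (h x) e) <= Rabs M'.
  apply: Rle_trans (Rle_abs M'); apply: (HM' e x); last by rewrite /r; lra.
  by have := near_le v y ltac:(lra) e he; rewrite /r; lra.
(* The increment is taken along the broken path (x, y), (x, v), (u, v); the locally bounded partial
   derivatives then give a Lipschitz estimate. *)
have -> : h u v - h x y = Derive (h^~ v) c * (u - x) + Derive (h x) e * (v - y) by lra.
apply: Rle_lt_trans (Rabs_triang _ _) _; rewrite !Rabs_mult.
have M0 := Rabs_pos M; have M'0 := Rabs_pos M'; have ux := Rabs_pos (u - x); have vy := Rabs_pos (v - y).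
have e1 : K * (eps / K) = eps by field; lra.
apply: (Rle_lt_trans _ (Rabs M * (eps / K) + Rabs M' * (eps / K))).
  apply: Rplus_le_compat; apply: Rmult_le_compat => //; try exact: Rabs_pos; lra.
have : 0 < eps / K by apply: Rdiv_lt_0_compat.
by move: e1; move: (eps / K) => q; rewrite /K; lra.
Qed.

(** Continuity of one partial derivative and existence of the other make [h] differentiable at the
    point, so the usual chain rule applies. *)
Lemma Derive_diagonal h x : smooth2 h ->
  Derive (fun s => h s s) x = Derive (h^~ x) x + Derive (h x) x.
Proof.
move=> sh; have d : differentiable_pt_lim h x x (Derive (h^~ x) x) (Derive (h x) x).
  apply/filterdiff_differentiable_pt_lim.
  apply: (@is_derive_filterdiff h x x (fun s t => Derive (h^~ t) s)).
  - by apply: filter_forall => u; apply: Derive_correct; apply: smooth_ex_derive; apply: smooth2_l.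
  - by apply: Derive_correct; apply: smooth_ex_derive; apply: smooth2_r.
  - by apply/(@continuity_2d_pt_filterlim (fun s t => Derive (h^~ t) s)); apply: smooth2_continuity; apply: smooth2_partial_l.
apply: is_derive_unique; apply/is_derive_Reals.
have := @derivable_pt_lim_comp_2d h id id x _ _ 1 1 d (derivable_pt_lim_id x) (derivable_pt_lim_id x).
by rewrite !Rmult_1_r.
Qed.

Lemma smooth2_Schwarz h x y : smooth2 h ->
  Derive (fun s => Derive (h s) y) x = Derive (fun t => Derive (h^~ t) x) y.
Proof.
move=> sh; have shr := smooth2_partial_r sh; have shl := smooth2_partial_l sh.
apply: Schwarz.
- exists (mkposreal 1 Rlt_0_1) => u v _ _; do ![split]; apply: smooth_ex_derive.
  + exact: smooth2_l.
  + exact: smooth2_r.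
  + exact: (smooth2_l v shr).
  + exact: (smooth2_r u shl).
- by apply: smooth2_continuity; apply: (smooth2_partial_l shr).
- by apply: smooth2_continuity; apply: (smooth2_partial_r shl).
Qed.

(** * The Lie algebra of a Frölicher group *)

Lemma curve_comp (X : FrolicherSpace) (c : R -> X) (a : R -> R) :
  curve X c -> smooth a -> curve X (fun u => c (a u)).
Proof.
move=> /curveP cc sa; apply/curveP => f Ff.
by apply: (@smooth_comp (fun s => f (c s)) a) => //; apply: cc.
Qed.

Lemma curve_at_curve (X : FrolicherSpace) (x : X) (c : curve_at x) : curve X c.
Proof. by case: c => c []. Qed.

Lemma curve_at_0 (X : FrolicherSpace) (x : X) (c : curve_at x) : c 0 = x.
Proof. by case: c => c []. Qed.

Lemma smooth_fun_curve (X : FrolicherSpace) (f : X -> R) (c : R -> X) :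
  smooth_fun X f -> curve X c -> smooth (fun s => f (c s)).
Proof. by move=> Ff /curveP; apply. Qed.

Lemma smooth_fun_comp (X Y : FrolicherSpace) (phi : X -> Y) (f : Y -> R) :
  smooth_map phi -> smooth_fun Y f -> smooth_fun X (fun x => f (phi x)).
Proof.
by move=> sphi Ff; apply/smooth_funP => c cc; apply: (smooth_fun_curve Ff); apply: sphi.
Qed.

(** * Second derivatives of products and the vector space structure *)

Section Group.
Variable G : FrolicherGroup.
Local Notation S := (group_space G).
Local Notation g := (@tangent S 1%g).

Lemma smooth_fun_mull (f : S -> R) (a : S) :
  smooth_fun S f -> smooth_fun S (fun x => f (a * x)%g).
Proof.
apply: smooth_fun_comp => c cc.
exact: (@curve_mul G (fun=> a) c (curve_const (X := S) _) cc).
Qed.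

Lemma smooth_fun_mulr (f : S -> R) (a : S) :
  smooth_fun S f -> smooth_fun S (fun x => f (x * a)%g).
Proof.
apply: smooth_fun_comp => c cc.
exact: (@curve_mul G c (fun=> a) cc (curve_const (X := S) _)).
Qed.

Lemma smooth2_mul (f : S -> R) (p q : R -> R -> S) : smooth_fun S f ->
  (forall a b, smooth a -> smooth b -> curve S (fun u => p (a u) (b u))) ->
  (forall a b, smooth a -> smooth b -> curve S (fun u => q (a u) (b u))) ->
  smooth2 (fun s t => f (p s t * q s t)%g).
Proof.
move=> Ff hp hq a b sa sb; apply: (smooth_fun_curve Ff).
by apply: curve_mul; [apply: hp | apply: hq].
Qed.

Lemma smooth2_mul_curves (f : S -> R) (c d : R -> S) : smooth_fun S f ->
  curve S c -> curve S d -> smooth2 (fun s t => f (c s * d t)%g).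
Proof.
by move=> Ff cc cd; apply: smooth2_mul => // a b sa sb; apply: curve_comp.
Qed.

(** The function is the left-invariant derivative L_w f read along [c]; its smoothness is what
    allows such derivatives to be iterated. *)
Lemma smooth_dir_deriv_mull (f : S -> R) (c : R -> S) (w : g) :
  smooth_fun S f -> curve S c -> smooth (fun s => dir_deriv w (fun x => f (c s * x)%g)).
Proof.
move=> Ff cc; apply: (@smooth_partial_0 (fun s t => f (c s * repr w t)%g)).
by apply: smooth2_mul_curves => //; apply: curve_at_curve.
Qed.

Lemma smooth_dir_deriv_mulr (f : S -> R) (d : R -> S) (v : g) :
  smooth_fun S f -> curve S d -> smooth (fun t => dir_deriv v (fun x => f (x * d t)%g)).
Proof.
move=> Ff cd; apply: (@smooth_partial_0 (fun t s => f (repr v s * d t)%g)).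
apply: (@smooth2_swap (fun s t => f (repr v s * d t)%g)).
by apply: smooth2_mul_curves => //; apply: curve_at_curve.
Qed.

(** The form D_f(v, w), which is L_v L_w f at the identity for left-invariant derivatives L. *)
Definition mul_deriv2 (f : S -> R) (v w : g) : R :=
  Derive (fun s => dir_deriv w (fun x => f (repr v s * x)%g)) 0.

(** The innermost derivative depends only on the class of its curve. This settles [d] directly and
    [c] after exchanging the order of differentiation. *)
Lemma mul_deriv2_cls (f : S -> R) (c d : @curve_at S 1%g) : smooth_fun S f ->
  mul_deriv2 f (cls c) (cls d) = Derive (fun s => Derive (fun t => f (c s * d t)%g) 0) 0.
Proof.
move=> Ff; have cS (e : @curve_at S 1%g) : curve S e by apply: curve_at_curve.
rewrite /mul_deriv2 (Derive_ext _ (fun s => Derive (fun t => f (repr (cls c) s * d t)%g) 0)).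
  rewrite !(smooth2_Schwarz 0 0 (smooth2_mul_curves Ff (cS _) (cS _))).
  by apply: Derive_ext => t; exact: (@repr_cls _ _ c (fun x => f (x * d t)%g) (smooth_fun_mulr (d t) Ff)).
by move=> s; apply: dir_deriv_cls; apply: smooth_fun_mull.
Qed.

Lemma mul_deriv2E (f : S -> R) (v w : g) : smooth_fun S f ->
  mul_deriv2 f v w = Derive (fun s => Derive (fun t => f (repr v s * repr w t)%g) 0) 0.
Proof. by move=> Ff; rewrite -mul_deriv2_cls // !reprK. Qed.

Lemma mul_deriv2_swap (f : S -> R) (v w : g) : smooth_fun S f ->
  mul_deriv2 f v w = Derive (fun t => dir_deriv v (fun x => f (x * repr w t)%g)) 0.
Proof.
move=> Ff; rewrite mul_deriv2E //.
by rewrite (smooth2_Schwarz 0 0 (smooth2_mul_curves Ff (curve_at_curve _) (curve_at_curve _))).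
Qed.

Lemma Derive_lin_comb (p q : R -> R) r x : smooth p -> smooth q ->
  Derive (fun s => p s + r * q s) x = Derive p x + r * Derive q x.
Proof.
move=> sp sq; rewrite Derive_plus ?Derive_scal //; first exact: smooth_ex_derive.
by apply: smooth_ex_derive; apply: smooth_mult => //; apply: smooth_const.
Qed.

Lemma mul_deriv2_linear_r (f : S -> R) (z u v w : g) r : smooth_fun S f ->
  is_lin_comb u v r w -> mul_deriv2 f z u = mul_deriv2 f z v + r * mul_deriv2 f z w.
Proof.
move=> Ff Hu; rewrite /mul_deriv2 -Derive_lin_comb; last first.
- by apply: smooth_dir_deriv_mull => //; apply: curve_at_curve.
- by apply: smooth_dir_deriv_mull => //; apply: curve_at_curve.
by apply: Derive_ext => s; apply: Hu; apply: smooth_fun_mull.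
Qed.

Lemma mul_deriv2_linear_l (f : S -> R) (z u v w : g) r : smooth_fun S f ->
  is_lin_comb u v r w -> mul_deriv2 f u z = mul_deriv2 f v z + r * mul_deriv2 f w z.
Proof.
move=> Ff Hu; rewrite !mul_deriv2_swap // -Derive_lin_comb; last first.
- by apply: smooth_dir_deriv_mulr => //; apply: curve_at_curve.
- by apply: smooth_dir_deriv_mulr => //; apply: curve_at_curve.
by apply: Derive_ext => s; apply: Hu; apply: smooth_fun_mulr.
Qed.

(** The diagonal chain rule for f(c(s) d(t)): at 0 the other factor is the identity. In particular
    [tadd] is independent of the chosen representatives. *)
Lemma dir_deriv_tadd (v w : g) (f : S -> R) : smooth_fun S f ->
  dir_deriv (tadd v w) f = dir_deriv v f + dir_deriv w f.
Proof.
move=> Ff; rewrite dir_deriv_cls //=.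
rewrite (Derive_diagonal 0 (smooth2_mul_curves Ff (curve_at_curve (repr v)) (curve_at_curve (repr w)))).
congr (_ + _); apply: Derive_ext => s; by rewrite curve_at_0 ?mulg1 ?mul1g.
Qed.

Lemma tadd_lin_comb (v w : g) r : is_lin_comb (tadd v (tscale r w)) v r w.
Proof. by move=> f Ff; rewrite dir_deriv_tadd // dir_deriv_tscale. Qed.

(** Directional derivatives separate tangent vectors, so each axiom becomes an identity between
    reals. *)
Lemma tangent_vector_space : is_vector_space (tzero (1%g : S)) (@tadd G) (@tscale S 1%g).
Proof.
split=> *.
all: try by apply: dir_deriv_inj => f Ff;
  rewrite ?(dir_deriv_tadd, dir_deriv_tscale, dir_deriv_tzero) //; ring.
match goal with u : _ |- _ => exists (tscale (-1) u) end.
by apply: dir_deriv_inj => f Ff; rewrite dir_deriv_tadd // dir_deriv_tscale // dir_deriv_tzero //; ring.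
Qed.

(** * The mixed derivative of the group commutator *)

Lemma curve_commutator (c d : @curve_at S 1%g) (a b : R -> R) :
  smooth a -> smooth b ->
  curve S (fun u => (c (a u) * d (b u) * (c (a u))^-1 * (d (b u))^-1)%g).
Proof.
move=> sa sb.
have cc := curve_comp (curve_at_curve c) sa; have cd := curve_comp (curve_at_curve d) sb.
have h1 := curve_mul cc cd; have h2 := curve_mul h1 (curve_inv cc).
exact: (curve_mul h2 (curve_inv cd)).
Qed.

Lemma commutator_deriv2 (f : S -> R) (c d : @curve_at S 1%g) : smooth_fun S f ->
  Derive (fun s => Derive (fun t => f (commutator_curve c d s t)) 0) 0 =
  mul_deriv2 f (cls c) (cls d) - mul_deriv2 f (cls d) (cls c).
Proof.
move=> Ff; have cS (e : @curve_at S 1%g) : curve S e by apply: curve_at_curve.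
pose gam s t : S := (c s * d t * (c s)^-1 * (d t)^-1)%g.
have cgam a b : smooth a -> smooth b -> curve S (fun u => gam (a u) (b u)).
  exact: curve_commutator.
(* The two occurrences of s in gamma(s,t) c(s) are separated, so that the diagonal rule applies;
   since gamma(0,t) = e, varying the trailing factor contributes nothing. *)
pose K s s' := Derive (fun t => f (gam s t * c s')%g) 0.
have sK : smooth2 K.
  move=> a b sa sb; apply: (@smooth_partial_0 (fun u t => f (gam (a u) t * c (b u))%g)).
  apply: smooth2_mul => // p q sp sq; first by apply: cgam => //; apply: smooth_comp.
  by apply: (curve_comp (cS c)); apply: smooth_comp.
have K0s s' : K 0 s' = 0.
  rewrite /K (Derive_ext _ (fun=> f (c s'))) ?Derive_const // => t.
  by rewrite /gam curve_at_0 invg1 mul1g mulg1 mulgV mul1g.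
have sdc := smooth2_swap (smooth2_mul_curves Ff (cS d) (cS c)).
have E : mul_deriv2 f (cls c) (cls d) =
    Derive (fun s => K s s + 1 * Derive (fun t => f (d t * c s)%g) 0) 0.
  rewrite mul_deriv2_cls //; apply: Derive_ext => s.
  (* From c(s)d(t) = gamma(s,t) d(t)c(s), with the two occurrences of t separated: the derivative on
     the diagonal splits into [K s s] and that of f(d(t) c(s)). *)
  pose H t t' := f (gam s t * (d t' * c s))%g.
  rewrite (Derive_ext (fun t => f (c s * d t)%g) (fun t => H t t)) => [|t]; last first.
    by rewrite /H /gam !mulgA mulgVK mulgVK.
  rewrite (@Derive_diagonal H) /H.
    rewrite Rmult_1_l; congr (_ + _); apply: Derive_ext => t.
      by rewrite curve_at_0 mul1g.
    by rewrite /gam curve_at_0 invg1 !mulg1 mulgV mul1g.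
  apply: smooth2_mul => // a b sa sb.
    exact: (@cgam (fun=> s) a (smooth_const s) sa).
  by have := curve_mul (curve_comp (cS d) sb) (curve_const (X := S) (c s)).
rewrite E Derive_lin_comb; first last.
- exact: (smooth_partial_0 sdc).
- exact: (sK (fun s => s) (fun s => s) smooth_id smooth_id).
rewrite (Derive_diagonal 0 sK) (Derive_ext (K 0) (fun=> 0)) // Derive_const.
(* The remaining term differentiates f(d(t)c(s)) first in t; exchanging the order makes it D_f of
   [d] and [c]. *)
rewrite (smooth2_Schwarz 0 0 sdc) -mul_deriv2_cls // Rmult_1_l.
suff -> : Derive (K^~ 0) 0 = Derive (fun s => Derive (fun t => f (commutator_curve c d s t)) 0) 0.
  ring.
apply: Derive_ext => s; apply: Derive_ext => t.
by rewrite /gam (curve_at_0 c) mulg1.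
Qed.

(** * Third-order left-invariant operators L_u L_v L_w and the Jacobi identity *)

Definition mul_deriv3 (f : S -> R) (u v w : g) : R :=
  Derive (fun s => mul_deriv2 (fun x => f (repr u s * x)%g) v w) 0.

Lemma smooth2_mul_deriv3 (f : S -> R) (a b c : R -> S) : smooth_fun S f ->
  curve S a -> curve S b -> curve S c ->
  smooth2 (fun s r => Derive (fun t => f (a s * (b r * c t))%g) 0).
Proof.
move=> Ff ca cb cc p q sp sq.
apply: (@smooth_partial_0 (fun u t => f (a (p u) * (b (q u) * c t))%g)).
apply: smooth2_mul => // p' q' sp' sq'.
  by apply: (curve_comp ca); apply: smooth_comp.
by apply: curve_mul; apply: curve_comp => //; apply: smooth_comp.
Qed.

Lemma smooth_mul_deriv2_mull (f : S -> R) (a : R -> S) (v w : g) : smooth_fun S f ->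
  curve S a -> smooth (fun s => mul_deriv2 (fun x => f (a s * x)%g) v w).
Proof.
move=> Ff ca; have := smooth_partial_0
  (smooth2_mul_deriv3 Ff ca (curve_at_curve (repr v)) (curve_at_curve (repr w))).
by apply: smooth_ext => s; rewrite mul_deriv2E //; apply: smooth_fun_mull.
Qed.

(** After regrouping v(s) w(r) u(t) by associativity, two exchanges of derivatives carry t from the
    outermost place past s and then past r. *)
Lemma mul_deriv3_swap (f : S -> R) (u v w : g) : smooth_fun S f ->
  mul_deriv3 f v w u = Derive (fun t => mul_deriv2 (fun x => f (x * repr u t)%g) v w) 0 /\
  smooth (fun t => mul_deriv2 (fun x => f (x * repr u t)%g) v w).
Proof.
move=> Ff; pose a := repr v; pose b := repr w; pose c := repr u.
have cS (e : @curve_at S 1%g) : curve S e by apply: curve_at_curve.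
pose K t s := Derive (fun r => f (a s * (b r * c t))%g) 0.
have sK : smooth2 K.
  move=> p q sp sq; apply: (@smooth_partial_0 (fun x r => f (a (q x) * (b r * c (p x)))%g)).
  apply: smooth2_mul => // p' q' sp' sq'.
    by apply: (curve_comp (cS a)); apply: smooth_comp.
  by apply: curve_mul; apply: curve_comp => //; apply: smooth_comp.
have E t : mul_deriv2 (fun x => f (x * repr u t)%g) v w = Derive (K t) 0.
  rewrite mul_deriv2E; last exact: smooth_fun_mulr.
  by apply: Derive_ext => s; apply: Derive_ext => r; rewrite -mulgA.
split; last by apply: (smooth_ext (fun t => esym (E t))); apply: smooth_partial_0.
rewrite (Derive_ext _ _ _ E) (smooth2_Schwarz 0 0 sK) /mul_deriv3.
apply: Derive_ext => s; rewrite mul_deriv2E; last exact: smooth_fun_mull.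
have sbc := smooth2_mul_curves (smooth_fun_mull (a s) Ff) (cS b) (cS c).
by rewrite (smooth2_Schwarz 0 0 sbc).
Qed.

(** At the identity, [z] acts as L_v L_w - L_w L_v. This determines [z] without reference to [Xi] or
    to representatives. *)
Definition commutator_deriv (z v w : g) : Prop := forall f, smooth_fun S f ->
  dir_deriv z f = mul_deriv2 f v w - mul_deriv2 f w v.

(** The rule for [z] is applied to left translates of [f] when [z] is the second argument, and to
    right translates when it is the first. *)
Lemma mul_deriv2_commutator (f : S -> R) (u v w z : g) : smooth_fun S f ->
  commutator_deriv z v w ->
  mul_deriv2 f u z = mul_deriv3 f u v w - mul_deriv3 f u w v /\
  mul_deriv2 f z u = mul_deriv3 f v w u - mul_deriv3 f w v u.
Proof.
move=> Ff Hz; split.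
  rewrite /mul_deriv2 /mul_deriv3 -Derive_minus.
  - by apply: Derive_ext => s; apply: Hz; apply: smooth_fun_mull.
  - by apply: smooth_ex_derive; apply: smooth_mul_deriv2_mull => //; apply: curve_at_curve.
  - by apply: smooth_ex_derive; apply: smooth_mul_deriv2_mull => //; apply: curve_at_curve.
have [-> sv] := mul_deriv3_swap u v w Ff; have [-> sw] := mul_deriv3_swap u w v Ff.
rewrite mul_deriv2_swap // -Derive_minus; try exact: smooth_ex_derive.
by apply: Derive_ext => t; apply: Hz; apply: smooth_fun_mulr.
Qed.

Lemma commutator_deriv_lie_bracket (br : g -> g -> g) :
  (forall v w, commutator_deriv (br v w) v w) ->
  is_lie_bracket (tzero (1%g : S)) (@tadd G) (@tscale S 1%g) br.
Proof.
move=> Hbr; split.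
- move=> w r u v; apply: dir_deriv_inj => f Ff.
  rewrite (tadd_lin_comb _ _ _ Ff) !Hbr //.
  have L := tadd_lin_comb u v r.
  by rewrite (mul_deriv2_linear_l w Ff L) (mul_deriv2_linear_r w Ff L); ring.
- move=> w r u v; apply: dir_deriv_inj => f Ff.
  rewrite (tadd_lin_comb _ _ _ Ff) !Hbr //.
  have L := tadd_lin_comb u v r.
  by rewrite (mul_deriv2_linear_l w Ff L) (mul_deriv2_linear_r w Ff L); ring.
- by move=> v; apply: dir_deriv_inj => f Ff; rewrite Hbr // dir_deriv_tzero //; ring.
- move=> u v w; apply: dir_deriv_inj => f Ff.
  rewrite !dir_deriv_tadd // !Hbr // dir_deriv_tzero //.
  (* Each double bracket expands into four triple derivatives; the twelve terms cancel in pairs. *)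
  have [-> ->] := mul_deriv2_commutator u Ff (Hbr v w).
  have [-> ->] := mul_deriv2_commutator v Ff (Hbr w u).
  have [-> ->] := mul_deriv2_commutator w Ff (Hbr u v).
  ring.
Qed.

(** * The bracket obtained through [Xi] *)

Lemma commutator_deriv_unique (z z' v w : g) :
  commutator_deriv z v w -> commutator_deriv z' v w -> z = z'.
Proof. by move=> Hz Hz'; apply: dir_deriv_inj => f Ff; rewrite Hz // Hz'. Qed.

Lemma smooth_fun_dir_deriv (f : S -> R) : smooth_fun S f ->
  smooth_fun (lie_space G) (fun v => dir_deriv v f).
Proof. by move=> Ff; apply/smooth_funP => c /tangent_space_curveP; apply. Qed.

(** Both classes are tested on the smooth function [dir_deriv] along [f]: the line s z gives the
    derivative of [f] along [z], the curve [xi] the mixed derivative of f(gamma(s,t)). *)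
Lemma Xi_commutator_deriv (z : g) (c d : @curve_at S 1%g)
    (xi : @curve_at (lie_space G) (tzero (1%g : S))) :
  (forall s, xi s = cls (commutator_curve c d s)) -> Xi z = cls xi ->
  commutator_deriv z (cls c) (cls d).
Proof.
move=> Exi /clsP Ez f Ff; rewrite -commutator_deriv2 //.
have /= := Ez _ (smooth_fun_dir_deriv Ff).
rewrite (Derive_ext _ (fun s => s * dir_deriv z f)) => [|s]; last exact: dir_deriv_tscale.
rewrite Derive_scal_l Derive_id Rmult_1_l => ->.
by apply: Derive_ext => s; rewrite Exi dir_deriv_cls.
Qed.

Lemma is_commutator_bracket_deriv (br : lie_space G -> lie_space G -> lie_space G) :
  is_commutator_bracket br -> forall v w, commutator_deriv (br v w) v w.
Proof.
move=> Hbr v w; have [xi [Exi Ez]] := Hbr (repr v) (repr w).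
by have := Xi_commutator_deriv Exi Ez; rewrite !reprK.
Qed.

(** Smoothness in s means that the partial derivative of f(gamma(s,t)) at t = 0 is smooth, as
    [smooth_partial_0] provides. *)
Lemma commutator_class_curveP (c d : @curve_at S 1%g) :
  curve (lie_space G) (fun s => cls (commutator_curve c d s)) /\
  cls (commutator_curve c d 0) = tzero (1%g : S).
Proof.
split; last first.
  apply/clsP => f Ff; apply: Derive_ext => t /=.
  by rewrite curve_at_0 invg1 mul1g mulg1 mulgV.
apply/tangent_space_curveP => f Ff.
have : smooth2 (fun s t => f (commutator_curve c d s t)).
  move=> a b sa sb; apply: (smooth_fun_curve Ff).
  exact: curve_commutator.
by move=> /smooth_partial_0; apply: smooth_ext => s; rewrite dir_deriv_cls.
Qed.

Definition commutator_class_curve (c d : @curve_at S 1%g) :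
    @curve_at (lie_space G) (tzero (1%g : S)) :=
  exist _ (fun s => cls (commutator_curve c d s)) (commutator_class_curveP c d).

Lemma commutator_bracket_exists : bijective (@Xi S 1%g) ->
  exists br : lie_space G -> lie_space G -> lie_space G, is_commutator_bracket br.
Proof.
case=> inv _ invK; pose z c d := inv (cls (commutator_class_curve c d)).
have zP c d : commutator_deriv (z c d) (cls c) (cls d).
  by apply: (@Xi_commutator_deriv _ _ _ (commutator_class_curve c d)) => //; apply: invK.
exists (fun v w => z (repr v) (repr w)) => c d.
exists (commutator_class_curve c d); split=> //.
(* Independence of representatives: both vectors satisfy [commutator_deriv] for the same pair of
   classes. *)
suff -> : z (repr (cls c)) (repr (cls d)) = z c d by apply: invK.
have := zP (repr (cls c)) (repr (cls d)); rewrite !reprK.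
by move=> H; apply: commutator_deriv_unique H (zP c d).
Qed.
End Group.

(** * Tangent maps of smooth homomorphisms *)

Section Morphism.
Variables (G H : FrolicherGroup) (alpha : {multiplicative G -> H}).
Variable alphaS : @smooth_map (group_space G) (group_space H) alpha.
Local Notation f_alpha f := (fun x : group_space G => f (alpha x)).

Lemma dir_deriv_lie_map (v : lie_space G) (f : group_space H -> R) :
  smooth_fun (group_space H) f ->
  dir_deriv (lie_map alphaS v) f = dir_deriv v (f_alpha f).
Proof. by move=> Ff; rewrite dir_deriv_cls. Qed.

(** Multiplicativity of [alpha] turns a product of image curves into the image of the product. *)
Lemma mul_deriv2_lie_map (v w : lie_space G) (f : group_space H -> R) :
  smooth_fun (group_space H) f ->
  mul_deriv2 f (lie_map alphaS v) (lie_map alphaS w) = mul_deriv2 (f_alpha f) v w.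
Proof.
move=> Ff; rewrite mul_deriv2_cls // mul_deriv2E; last exact: (smooth_fun_comp alphaS).
by apply: Derive_ext => s; apply: Derive_ext => t; rewrite /= gmulfM.
Qed.

Lemma lie_map_commutator_deriv (z v w : lie_space G) : commutator_deriv z v w ->
  commutator_deriv (lie_map alphaS z) (lie_map alphaS v) (lie_map alphaS w).
Proof.
move=> Hz f Ff; rewrite dir_deriv_lie_map // !mul_deriv2_lie_map //.
by apply: Hz; apply: (smooth_fun_comp alphaS).
Qed.
End Morphism.

Theorem theorem7 (G : FrolicherGroup)
  (XiG : bijective (@Xi (group_space G) 1%g)) :
  let zeroG := tzero (X := group_space G) 1%g in
  let scaleG := @tscale (group_space G) 1%g in
  (is_vector_space zeroG (@tadd G) scaleG /\
   forall (v w : lie_space G) (r : R), is_lin_comb (tadd v (scaleG r w)) v r w) /\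
  (exists! brG : lie_space G -> lie_space G -> lie_space G, is_commutator_bracket brG) /\
  (forall brG : lie_space G -> lie_space G -> lie_space G,
    is_commutator_bracket brG ->
    is_lie_bracket zeroG (@tadd G) scaleG brG /\
    forall (H : FrolicherGroup)
      (XiH : bijective (@Xi (group_space H) 1%g))
      (brH : lie_space H -> lie_space H -> lie_space H),
    is_commutator_bracket brH ->
    forall (alpha : {multiplicative G -> H})
      (alphaS : @smooth_map (group_space G) (group_space H) alpha),
    is_linear_map (@tadd G) scaleG
      (@tadd H) (@tscale (group_space H) 1%g) (lie_map alphaS) /\
    forall v w : lie_space G,
      lie_map alphaS (brG v w) = brH (lie_map alphaS v) (lie_map alphaS w)).
Proof.
move=> zeroG scaleG; split; last split.
- by split; [exact: tangent_vector_space | exact: tadd_lin_comb].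
- have [br Hbr] := commutator_bracket_exists XiG; exists br; split=> // br' Hbr'.
  apply: functional_extensionality => v; apply: functional_extensionality => w.
  exact: commutator_deriv_unique (is_commutator_bracket_deriv Hbr v w)
    (is_commutator_bracket_deriv Hbr' v w).
move=> brG /is_commutator_bracket_deriv HG; split; first exact: commutator_deriv_lie_bracket.
move=> H _ brH /is_commutator_bracket_deriv HH alpha alphaS; split=> [r u v|v w].
  apply: dir_deriv_inj => f Ff.
  rewrite (tadd_lin_comb _ _ _ Ff) !dir_deriv_lie_map //.
  by apply: tadd_lin_comb; apply: (smooth_fun_comp alphaS).
(* Both sides satisfy [commutator_deriv] for the images of [v] and [w], hence coincide. *)
exact: commutator_deriv_unique (lie_map_commutator_deriv alphaS (HG v w)) (HH _ _).
Qed.
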